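(* Let $A$ be a ring and let $\mathscr{T}=(\mathfrak{C},B,\langle -,-\rangle)$ be a right rational pairing over $A$ with rational functor $\mathrm{Rat}^{\mathscr{T}}:\mathsf{Mod}_B\to\mathsf{Mod}_B$, and put $\mathfrak{a}=\mathrm{Rat}^{\mathscr{T}}(B_B)$. Assume that $\mathrm{Rat}^{\mathscr{T}}$ is an exact functor. Let $M$ be a right $\mathfrak{C}$-comodule, and $E(M_{\mathfrak{C}})$ its injective hull in $\mathsf{Comod}_{\mathfrak{C}}$. (a) The map $$\zeta_M: M\to\mathrm{Hom}_B(\mathfrak{a},E(M_{\mathfrak{C}})),\qquad \zeta_M(m)(a)=ma\quad(m\in M,\ a\in\mathfrak{a}),$$ gives an injective envelope of $M$ in $\mathsf{Mod}_B$. (b) $M$ is injective in $\mathsf{Mod}_B$ if and only if $M$ is injective in $\mathsf{Comod}_{\mathfrak{C}}$ and $\zeta_M$ is an isomorphism. (c) If ${}_AB$ is flat, $\zeta_M$ is an isomorphism, and $M$ is injective in $\mathsf{Comod}_{\mathfrak{C}}$, then $M$ is injective in $\mathsf{Mod}_A$. (d) If $\mathfrak{a}$ has a set of local units and $M$ is of finite support, then $M$ is injective in $\mathsf{Comod}_{\mathfrak{C}}$ if and only if $M$ is injective in $\mathsf{Mod}_B$. (e) Assume that $\mathfrak{a}$ has a set of local units, $M$ is of finite support and ${}_AB$ is flat. If $M$ is injective in $\mathsf{Comod}_{\mathfrak{C}}$, then $M$ is injective in $\mathsf{Mod}_A$.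
   Context: Rings are associative unital algebras over a commutative ring $K$. An $A$-coring is an $A$-bimodule $\mathfrak{C}$ with $A$-bimodule maps $\Delta:\mathfrak{C}\to\mathfrak{C}\otimes_A\mathfrak{C}$ (coassociative) and $\varepsilon:\mathfrak{C}\to A$ (counit). $\mathsf{Comod}_{\mathfrak{C}}$ is the category of right $\mathfrak{C}$-comodules, i.e. right $A$-modules $M$ with a coassociative, counital right $A$-linear map $M\to M\otimes_A\mathfrak{C}$. ${}^*\mathfrak{C}=\mathrm{Hom}({}_A\mathfrak{C},{}_AA)$ is the left dual convolution ring, with product $(f\cdot g)(c)=\sum f(c_{(1)}g(c_{(2)}))$ and unit $\varepsilon$. A right rational pairing over $A$ is a triple $\mathscr{T}=(\mathfrak{C},B,\langle-,-\rangle)$ with $\mathfrak{C}$ an $A$-coring, $B$ an $A$-ring (a ring with a ring homomorphism $A\to B$), and $\langle-,-\rangle:\mathfrak{C}\times B\to A$ a balanced $A$-bilinear form ($\langle ac,b\rangle=a\langle c,b\rangle$, $\langle c,ba\rangle=\langle c,b\rangle a$, $\langle ca,b\rangle=\langle c,ab\rangle$) such that: (1) $\beta_A:B\to{}^*\mathfrak{C}$, $b\mapsto[c\mapsto\langle c,b\rangle]$, is a ring anti-homomorphism; and (2) for each right $A$-module $M$ the map $\alpha_M:M\otimes_A\mathfrak{C}\to\mathrm{Hom}(B_A,M_A)$, $m\otimes_A c\mapsto[b\mapsto m\langle c,b\rangle]$, is injective. An element $m$ of a right $B$-module $M$ is rational if there is a finite set $\{(c_i,m_i)\}\subseteq\mathfrak{C}\times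 M$ with $mb=\sum_i m_i\langle c_i,b\rangle$ for all $b\in B$. The set $\mathrm{Rat}^{\mathscr{T}}(M)$ of rational elements is a $B$-submodule of $M$. The full subcategory $\mathrm{Rat}^{\mathscr{T}}(\mathsf{Mod}_B)$ of modules $M$ with $\mathrm{Rat}^{\mathscr{T}}(M)=M$ is closed under submodules, quotients and direct sums and is known to be isomorphic to $\mathsf{Comod}_{\mathfrak{C}}$; every right $\mathfrak{C}$-comodule $M$ is thereby a right $B$-module with $mb=\sum m_{(0)}\langle m_{(1)},b\rangle$. $\mathfrak{a}$ is a two-sided ideal of $B$, and $\mathrm{Hom}_B(\mathfrak{a},N)$ is a right $B$-module via $(fb)(x)=f(bx)$. $M$ is regarded as a subcomodule of $E(M_{\mathfrak{C}})$. $\mathfrak{a}$ has a set of local units if it contains a set $E$ of commuting idempotents such that for every $x\in\mathfrak{a}$ there exists $e\in E$ with $xe=ex=x$. Relative to such a set $E$, a right $B$-module $M$ is of finite support if there exists a finite subset $F\subseteq E$ such that $m\sum_{e\in F}e=m$ for every $m\in M$. *)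

(* Defs.v *)
From HB Require Import structures.
From mathcomp Require Import all_boot all_order all_algebra.
From mathcomp Require Import generic_quotient ring_quotient freeg boolp.

Set Implicit Arguments.
Unset Strict Implicit.
Unset Printing Implicit Defensive.

Import GRing.Theory.
Local Open Scope ring_scope.
Local Open Scope quotient_scope.

Lemma linear_eq (R : pzRingType) (U V : lmodType R) (f g : {linear U -> V}) :
  f =1 g -> f = g.
Proof.
move=> /funext; case: f g => [f [[f1] [f2]]] [g [[g1] [g2]]] /= fg.
subst g; congr (GRing.Linear.Pack (GRing.Linear.Class _ _));
  congr (_ _); exact: Prop_irrelevance.
Qed.

Notation rmodType R := (lmodType R^c).

Definition rscale (R : pzRingType) (M : rmodType R) (m : M) (r : R) : M :=
  (r : R^c) *: m.
Notation "m ** r" := (rscale m r) (at level 40, left associativity).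

Section RightScale.
Variables (R : pzRingType) (M N : rmodType R).
Lemma rscaleDl (m m' : M) r : (m + m') ** r = m ** r + m' ** r.
Proof. exact: scalerDr. Qed.
Lemma rscaleDr (m : M) r r' : m ** (r + r') = m ** r + m ** r'.
Proof. exact: scalerDl. Qed.
Lemma rscaleA (m : M) r r' : m ** (r * r') = m ** r ** r'.
Proof. by rewrite /rscale scalerA. Qed.
Lemma rscale1 (m : M) : m ** 1 = m.
Proof. exact: scale1r. Qed.
Lemma rscale0l r : (0 : M) ** r = 0.
Proof. exact: scaler0. Qed.
Lemma rscale0r (m : M) : m ** 0 = 0.
Proof. exact: scale0r. Qed.
Lemma rscale_linear (f : {linear M -> N}) (m : M) r : f (m ** r) = f m ** r.
Proof. exact: linearZ. Qed.
End RightScale.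

Section Tensor.
Variables (A : pzRingType) (M : rmodType A) (N : lmodType A).

Variant tensor_relator : {freeg (M * N)} -> Prop :=
| TensorAddl m m' n :
    tensor_relator (<<(m + m', n)>> - <<(m, n)>> - <<(m', n)>>)
| TensorAddr m n n' :
    tensor_relator (<<(m, n + n')>> - <<(m, n)>> - <<(m, n')>>)
| TensorBal m a n :
    tensor_relator (<<(m ** a, n)>> - <<(m, a *: n)>>).

Definition tensor_null : {pred {freeg (M * N)}} := fun x =>
  `[< forall S : {pred {freeg (M * N)}}, zmod_closed S ->
        (forall y, tensor_relator y -> y \in S) -> x \in S >].

Lemma tensor_null_closed : zmod_closed tensor_null.
Proof.
split=> [|x y /asboolP Sx /asboolP Sy]; apply/asboolP => S Sc rS.
  by case: Sc.
by case: (Sc) => _; apply; [apply: Sx | apply: Sy].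
Qed.
HB.instance Definition _ :=
  GRing.isZmodClosed.Build {freeg (M * N)} tensor_null tensor_null_closed.

(* M (x)_A N: the free abelian group on M x N modulo the subgroup generated by
   the relators. *)
Definition tensor : Type := Quotient.quot tensor_null.
HB.instance Definition _ := GRing.Zmodule.on tensor.

Definition pure (m : M) (n : N) : tensor := \pi_(Quotient.quot tensor_null) <<(m, n)>>.
End Tensor.

Arguments tensor_null {A} M N x.
Notation "m \ox n" := (pure m n) (at level 40, left associativity).

Section TensorLift.
Variables (A : pzRingType) (M : rmodType A) (N : lmodType A) (G : zmodType).

Definition balanced (f : M -> N -> G) : Prop :=
  [/\ forall m m' n, f (m + m') n = f m n + f m' n,
      forall m n n', f m (n + n') = f m n + f m n'
    & forall m a n, f (m ** a) n = f m (a *: n)].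

(* The map M (x) N -> G with m (x) n |-> f m n; meaningful for balanced f. *)
Definition tlift (f : M -> N -> G) (t : tensor M N) : G :=
  fglift (fun p : M * N => f p.1 p.2 : zmodule G)
    (repr (t : Quotient.quot (tensor_null M N))).

Let fgl (f : M -> N -> G) : {freeg (M * N)} -> zmodule G :=
  fglift (fun p : M * N => f p.1 p.2 : zmodule G).

Let fglB f : {morph fgl f : x y / x - y}.
Proof. exact: lift_is_additive. Qed.

Let fgl0 f : fgl f 0 = 0.
Proof. by rewrite -[0 in LHS](subrr 0) fglB subrr. Qed.

Let fglD f : {morph fgl f : x y / x + y}.
Proof. by move=> x y; rewrite -[y in LHS]opprK fglB -[- y]add0r fglB fgl0 sub0r opprK. Qed.

Let fglU f m n : fgl f <<(m, n)>> = f m n.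
Proof. by rewrite /fgl liftU scale1r. Qed.

Let fgl_null f x : balanced f -> x \in tensor_null M N -> fgl f x = 0.
Proof.
case=> fDl fDr fA /asboolP/(_ [pred y | fgl f y == 0]) nx; apply/eqP/nx.
  split=> [|y z]; rewrite !inE ?fgl0 // => /eqP y0 /eqP z0.
  by rewrite fglB y0 z0 subrr.
by move=> _ [m m' n|m n n'|m a n]; rewrite inE !fglB !fglU ?fDl ?fDr ?fA;
  rewrite ?subrr // addrAC addrK subrr.
Qed.

Let tlift_pi f x : balanced f -> tlift f (\pi_(Quotient.quot (tensor_null M N)) x) = fgl f x.
Proof.
move=> bf; apply/eqP; rewrite -subr_eq0; apply/eqP.
rewrite -[LHS](@fglB f) (fgl_null bf) //.
by rewrite Quotient.idealrBE reprK.
Qed.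

Lemma tlift_pure f m n : balanced f -> tlift f (m \ox n) = f m n.
Proof. by move=> bf; rewrite [LHS]tlift_pi // fglU. Qed.

Lemma tliftD f s t : balanced f -> tlift f (s + t) = tlift f s + tlift f t.
Proof.
move=> bf; elim/quotP: s => x _; elim/quotP: t => y _.
by rewrite !tlift_pi // -fglD -tlift_pi //; congr tlift; rewrite !piE.
Qed.
End TensorLift.

Section TensorTheory.
Variables (A : pzRingType) (M : rmodType A) (N : lmodType A).
Implicit Types (m : M) (n : N) (t : tensor M N).

Let piT (x : {freeg (M * N)}) : tensor M N :=
  \pi_(Quotient.quot (tensor_null M N)) x.

Let piB : {morph piT : x y / x - y}.
Proof. by move=> x y; rewrite /piT !piE. Qed.

Let pi_rel x : tensor_relator x -> piT x = 0.
Proof.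
move=> rx; rewrite -[RHS](subrr (piT x)) -piB subrr /piT.
apply/eqP; rewrite -Quotient.idealrBE subr0.
by apply/asboolP => S _; apply.
Qed.

Lemma pureDl m m' n : (m + m') \ox n = m \ox n + m' \ox n.
Proof.
have /eqP := pi_rel (TensorAddl m m' n).
by rewrite !piB subr_eq add0r subr_eq => /eqP e; rewrite [RHS]addrC; exact: e.
Qed.

Lemma pureDr m n n' : m \ox (n + n') = m \ox n + m \ox n'.
Proof.
have /eqP := pi_rel (TensorAddr m n n').
by rewrite !piB subr_eq add0r subr_eq => /eqP e; rewrite [RHS]addrC; exact: e.
Qed.

Lemma pure_bal m a n : (m ** a) \ox n = m \ox (a *: n).
Proof. by have /eqP := pi_rel (TensorBal m a n); rewrite piB subr_eq0 => /eqP. Qed.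

Lemma pure0l n : (0 : M) \ox n = 0.
Proof. by apply: (addrI ((0 : M) \ox n)); rewrite -pureDl !addr0. Qed.

Lemma pure0r m : m \ox (0 : N) = 0.
Proof. by apply: (addrI (m \ox (0 : N))); rewrite -pureDr !addr0. Qed.

Lemma pureNl m n : (- m) \ox n = - (m \ox n).
Proof. by apply: (addrI (m \ox n)); rewrite -pureDl !subrr pure0l. Qed.

Lemma tensor_sum t : exists s : seq (M * N), t = \sum_(p <- s) p.1 \ox p.2.
Proof.
pose Q t := exists s : seq (M * N), t = \sum_(p <- s) p.1 \ox p.2.
have Q0 : Q 0 by exists [::]; rewrite big_nil.
have QB x y : Q x -> Q y -> Q (x - y).
  move=> [s ->] [s' ->]; exists (s ++ [seq (- p.1, p.2) | p <- s']).
  rewrite big_cat big_map -sumrN; congr (_ + _).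
  by apply: eq_bigr => p _; rewrite /= pureNl.
have QN x : Q x -> Q (- x) by move=> Qx; rewrite -sub0r; exact: QB.
have QD x y : Q x -> Q y -> Q (x + y).
  by move=> Qx Qy; rewrite -[y]opprK; apply: QB => //; exact: QN.
elim/quotP: t => x _; rewrite -/(piT x) -[x]freeg_sumE.
have piD u v : piT (u + v) = piT u + piT v by rewrite /piT !piE.
have pi0 : piT 0 = 0 by rewrite -(subrr 0) piB subrr.
have QU k p : Q (piT << k *g p >>).
  case: p => p1 p2.
  have QUn (k' : nat) : Q (piT << k'%:Z *g (p1, p2) >>).
    elim: k' => [|k' IHk]; first by rewrite freegU0 pi0.
    rewrite -addn1 PoszD -freegUD piD; apply: QD => //.
    by exists [:: (p1, p2)]; rewrite big_seq1.
  case: k => k'; first exact: QUn.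
  by rewrite NegzE -freegUN -sub0r piB pi0; apply: QB.
elim/big_ind: _ => [|u v Qu Qv|p _]; first by rewrite pi0.
  by rewrite piD; apply: QD.
exact: QU.
Qed.

Lemma tensor_ind (P : tensor M N -> Prop) :
  P 0 -> (forall m n, P (m \ox n)) ->
  (forall s t, P s -> P t -> P (s + t)) -> forall t, P t.
Proof.
move=> P0 Pp PD t; have [s ->] := tensor_sum t.
by elim/big_ind: _ => // p _; apply: Pp.
Qed.

Lemma tlift0 (G : zmodType) (f : M -> N -> G) :
  balanced f -> tlift f (0 : tensor M N) = 0.
Proof. by move=> bf; apply: (addrI (tlift f (0 : tensor M N))); rewrite -tliftD // !addr0. Qed.

Lemma tensor_ext (G : zmodType) (f g : tensor M N -> G) :
  {morph f : x y / x + y} -> {morph g : x y / x + y} ->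
  (forall m n, f (m \ox n) = g (m \ox n)) -> f =1 g.
Proof.
have mor0 (h : tensor M N -> G) : {morph h : x y / x + y} -> h 0 = 0.
  by move=> hD; apply: (addrI (h 0)); rewrite -hD !addr0.
move=> fD gD fg t; elim/tensor_ind: t => [|//|s t es et].
  by rewrite !mor0.
by rewrite fD gD es et.
Qed.
End TensorTheory.

Definition tmap (A : pzRingType) (M M' : rmodType A) (N N' : lmodType A)
    (f : M -> M') (g : N -> N') : tensor M N -> tensor M' N' :=
  tlift (fun m n => f m \ox g n).

Section TensorMap.
Variables (A : pzRingType) (M M' : rmodType A) (N N' : lmodType A).
Variables (f : M -> M') (g : N -> N').
Hypotheses (fD : {morph f : x y / x + y}) (gD : {morph g : x y / x + y}).
Hypotheses (fA : forall m a, f (m ** a) = f m ** a).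
Hypotheses (gA : forall a n, g (a *: n) = a *: g n).

Lemma tmap_balanced : balanced (fun m n => f m \ox g n).
Proof.
split=> *; first by rewrite fD pureDl.
  by rewrite gD pureDr.
by rewrite fA gA pure_bal.
Qed.
Lemma tmap_pure m n : tmap f g (m \ox n) = f m \ox g n.
Proof. exact: tlift_pure tmap_balanced. Qed.
Lemma tmapD : {morph tmap f g : x y / x + y}.
Proof. by move=> x y; exact: tliftD tmap_balanced. Qed.
End TensorMap.

(* An associative unital K-algebra. The library's algType K is not used because
   it excludes the zero ring. *)
Record kalgebra (K : comPzRingType) := KAlgebra {
  kalg_ring :> pzRingType;
  kscal : {rmorphism K -> kalg_ring};
  kscal_central : forall k x, kscal k * x = x * kscal k
}.

(* An A-bimodule, on which the two induced actions of K agree: a left module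
   with a commuting right action. *)
Record bimod (K : comPzRingType) (A : kalgebra K) := Bimod {
  bimod_left :> lmodType A;
  bact : bimod_left -> A -> bimod_left;
  bactDl : forall c d a, bact (c + d) a = bact c a + bact d a;
  bactDr : forall c a b, bact c (a + b) = bact c a + bact c b;
  bactA : forall c a b, bact c (a * b) = bact (bact c a) b;
  bact1 : forall c, bact c 1 = c;
  bactC : forall a c b, bact (a *: c) b = a *: bact c b;
  bactK : forall k c, kscal A k *: c = bact c (kscal A k)
}.

Section Bimod.
Variables (K : comPzRingType) (A : kalgebra K).

Definition rmod (C : bimod A) : Type := C.

Section RightModule.
Variable C : bimod A.
Definition rmod_scale (a : A^c) (c : rmod C) : rmod C := bact (c : C) a.
HB.instance Definition _ := GRing.Zmodule.on (rmod C).
Let rmod_scaleA a b c : rmod_scale a (rmod_scale b c) = rmod_scale (a * b) c.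
Proof. by rewrite /rmod_scale -bactA. Qed.
Let rmod_scale1 c : rmod_scale 1 c = c.
Proof. exact: bact1. Qed.
Let rmod_scaleDr : right_distributive rmod_scale +%R.
Proof. by move=> a c d; exact: bactDl. Qed.
Let rmod_scaleDl c : {morph rmod_scale^~ c : a b / a + b}.
Proof. by move=> a b; exact: bactDr. Qed.
HB.instance Definition _ := GRing.Zmodule_isLmodule.Build A^c (rmod C)
  rmod_scaleA rmod_scale1 rmod_scaleDr rmod_scaleDl.
End RightModule.

Section TensorRight.
Variables (M : rmodType A) (D : bimod A).
Definition tensor_ract (a : A^c) (t : tensor M D) : tensor M D :=
  tlift (fun m d => m \ox bact d a) t.

Let tensor_ract_bal a : balanced (fun (m : M) (d : D) => m \ox bact d a).
Proof.
split=> *; first exact: pureDl.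
  by rewrite bactDl pureDr.
by rewrite bactC pure_bal.
Qed.

Lemma tensor_ract_pure a m d : tensor_ract a (m \ox d) = m \ox bact d a.
Proof. exact: tlift_pure. Qed.

Let tensor_ractDr : right_distributive tensor_ract +%R.
Proof. by move=> a s t; exact: tliftD. Qed.

Let tensor_ractA a b t : tensor_ract a (tensor_ract b t) = tensor_ract (a * b) t.
Proof.
apply: (tensor_ext (f := tensor_ract a \o tensor_ract b)) => [x y|x y|m d] /=.
- by rewrite !tensor_ractDr.
- by rewrite tensor_ractDr.
- by rewrite !tensor_ract_pure -bactA.
Qed.

Let tensor_ract1 t : tensor_ract 1 t = t.
Proof.
apply: (tensor_ext (g := id)) => [x y|//|m d]; first exact: tensor_ractDr.
by rewrite tensor_ract_pure bact1.
Qed.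

Let tensor_ractDl t : {morph tensor_ract^~ t : a b / a + b}.
Proof.
move=> a b; apply: (tensor_ext (f := tensor_ract (a + b))
  (g := fun t => tensor_ract a t + tensor_ract b t)) => [x y|x y|m d].
- exact: tensor_ractDr.
- by rewrite !tensor_ractDr addrACA.
- by rewrite !tensor_ract_pure bactDr pureDr.
Qed.

HB.instance Definition _ := GRing.Zmodule_isLmodule.Build A^c (tensor M D)
  tensor_ractA tensor_ract1 tensor_ractDr tensor_ractDl.
End TensorRight.

Definition ltensor (C D : bimod A) : Type := tensor (rmod C) D.

Section TensorLeft.
Variables (C D : bimod A).
Definition tensor_lact (a : A) (t : ltensor C D) : ltensor C D :=
  tlift (fun (c : rmod C) (d : D) => ((a *: (c : C) : rmod C) \ox d)) t.
HB.instance Definition _ := GRing.Zmodule.on (ltensor C D).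

Let tensor_lact_bal a :
  balanced (fun (c : rmod C) (d : D) => ((a *: (c : C) : rmod C) \ox d)).
Proof.
split=> [c c' d|c d d'|c b d]; last 1 first.
- by rewrite -pure_bal /rscale /GRing.scale /= /rmod_scale bactC.
- by rewrite -pureDl; congr (_ \ox _); exact: (@scalerDr _ C).
- exact: pureDr.
Qed.

Lemma tensor_lact_pure a (c : C) d :
  tensor_lact a ((c : rmod C) \ox d) = (a *: c : rmod C) \ox d.
Proof. exact: tlift_pure. Qed.

Let tensor_lactDr : right_distributive tensor_lact +%R.
Proof. by move=> a s t; exact: tliftD. Qed.

Let tensor_lactA a b t : tensor_lact a (tensor_lact b t) = tensor_lact (a * b) t.
Proof.
apply: (tensor_ext (f := tensor_lact a \o tensor_lact b)) => [x y|x y|m d] /=.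
- by rewrite !tensor_lactDr.
- by rewrite tensor_lactDr.
- by rewrite !tensor_lact_pure scalerA.
Qed.

Let tensor_lact1 t : tensor_lact 1 t = t.
Proof.
apply: (tensor_ext (g := id)) => [x y|//|m d]; first exact: tensor_lactDr.
by rewrite tensor_lact_pure scale1r.
Qed.

Let tensor_lactDl t : {morph tensor_lact^~ t : a b / a + b}.
Proof.
move=> a b; apply: (tensor_ext (f := tensor_lact (a + b))
  (g := fun t => tensor_lact a t + tensor_lact b t)) => [x y|x y|m d].
- exact: tensor_lactDr.
- by rewrite !tensor_lactDr addrACA.
- by rewrite !tensor_lact_pure -pureDl; congr (_ \ox _); exact: (@scalerDl _ C).
Qed.

HB.instance Definition _ := GRing.Zmodule_isLmodule.Build A (ltensor C D)
  tensor_lactA tensor_lact1 tensor_lactDr tensor_lactDl.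

Definition tensor_bact (t : ltensor C D) (a : A) : ltensor C D :=
  (t : tensor (rmod C) D) ** a.

Let tactDl s t a : tensor_bact (s + t) a = tensor_bact s a + tensor_bact t a.
Proof. exact: rscaleDl. Qed.
Let tactDr t a b : tensor_bact t (a + b) = tensor_bact t a + tensor_bact t b.
Proof. exact: rscaleDr. Qed.
Let tactA t a b : tensor_bact t (a * b) = tensor_bact (tensor_bact t a) b.
Proof. exact: rscaleA. Qed.
Let tact1 t : tensor_bact t 1 = t.
Proof. exact: rscale1. Qed.
Let tactC a t b : tensor_bact (a *: t) b = a *: tensor_bact t b.
Proof.
apply: (tensor_ext (f := fun t : ltensor C D => tensor_bact (a *: t) b)
  (g := fun t : ltensor C D => a *: tensor_bact t b)) => [x y|x y|m d].
- by rewrite scalerDr tactDl.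
- by rewrite tactDl scalerDr.
- by rewrite /tensor_bact /rscale /GRing.scale /= !(tensor_lact_pure, tensor_ract_pure).
Qed.
Let tactK k t : kscal A k *: t = tensor_bact t (kscal A k).
Proof.
apply: (tensor_ext (f := fun t : ltensor C D => kscal A k *: t)
  (g := fun t : ltensor C D => tensor_bact t (kscal A k))) => [x y|x y|m d].
- by rewrite scalerDr.
- by rewrite tactDl.
rewrite /tensor_bact /rscale /GRing.scale /= !(tensor_lact_pure, tensor_ract_pure).
by rewrite bactK -[bact d _]bactK -pure_bal.
Qed.

Definition tensor_bimod : bimod A :=
  Bimod (bimod_left := ltensor C D) tactDl tactDr tactA tact1 tactC tactK.
End TensorLeft.

(* The associativity isomorphism (M (x) C) (x) D -> M (x) (C (x) D). *)
Definition tassoc (M : rmodType A) (C D : bimod A) :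
    tensor (tensor M C) D -> tensor M (tensor_bimod C D) :=
  tlift (fun (t : tensor M C) (d : D) =>
    tlift (fun (m : M) (c : C) => m \ox (((c : rmod C) \ox d) : tensor_bimod C D)) t).

Section TensorAssoc.
Variables (M : rmodType A) (C D : bimod A).

Let bal1 (d : D) : balanced (fun (m : M) (c : C) =>
  m \ox (((c : rmod C) \ox d) : tensor_bimod C D)).
Proof.
split=> [m m' c|m c c'|m a c]; first exact: pureDl.
  rewrite -pureDr; congr (_ \ox _); exact: (@pureDl _ (rmod C)).
by rewrite pure_bal [in LHS]/GRing.scale /= tensor_lact_pure.
Qed.

Let bal2 : balanced (fun (t : tensor M C) (d : D) =>
  tlift (fun (m : M) (c : C) =>
    m \ox (((c : rmod C) \ox d) : tensor_bimod C D)) t).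
Proof.
split=> [s t d|t d d'|t a d]; first exact: tliftD.
- apply: (tensor_ext (f := tlift (fun (m : M) (c : C) =>
      m \ox (((c : rmod C) \ox (d + d')) : tensor_bimod C D)))
    (g := fun t => tlift (fun (m : M) (c : C) =>
      m \ox (((c : rmod C) \ox d) : tensor_bimod C D)) t +
      tlift (fun (m : M) (c : C) =>
      m \ox (((c : rmod C) \ox d') : tensor_bimod C D)) t)) => [x y|x y|m c].
  + exact: tliftD.
  + by rewrite !tliftD // addrACA.
  + rewrite !tlift_pure // -pureDr; congr (_ \ox _); exact: pureDr.
- apply: (tensor_ext (f := fun t : tensor M C => tlift (fun (m : M) (c : C) =>
      m \ox (((c : rmod C) \ox d) : tensor_bimod C D)) (t ** a))
    (g := tlift (fun (m : M) (c : C) =>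
      m \ox (((c : rmod C) \ox (a *: d)) : tensor_bimod C D)))) => [x y|x y|m c].
  + by rewrite rscaleDl tliftD.
  + exact: tliftD.
  rewrite /rscale [in LHS]/GRing.scale /= tensor_ract_pure !tlift_pure //.
  congr (_ \ox _); exact: (@pure_bal _ (rmod C)).
Qed.

Lemma tassocD : {morph @tassoc M C D : x y / x + y}.
Proof. by move=> x y; exact: tliftD. Qed.

Lemma tassoc_pure (m : M) (c : C) (d : D) :
  tassoc ((m \ox c : tensor M C) \ox d) =
  m \ox (((c : rmod C) \ox d) : tensor_bimod C D).
Proof. by rewrite /tassoc !tlift_pure. Qed.
End TensorAssoc.
End Bimod.

Section Coring.
Variables (K : comPzRingType) (A : kalgebra K).

Record coring := Coring {
  coring_bimod :> bimod A;
  comul : {linear coring_bimod -> tensor_bimod coring_bimod coring_bimod};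
  counit : {linear coring_bimod -> A^o};
  comul_right : forall c a, comul (bact c a) = bact (comul c) a;
  counit_right : forall c a, counit (bact c a) = counit c * a;
  comul_coassoc : forall c,
    tassoc (tmap (M := rmod coring_bimod)
                 (M' := tensor (rmod coring_bimod) coring_bimod)
                 comul idfun (comul c)) =
    tmap (M := rmod coring_bimod) (M' := rmod coring_bimod) idfun comul (comul c);
  comul_counitl : forall c,
    tlift (fun (x : rmod coring_bimod) (y : coring_bimod) => (counit x : A) *: y)
      (comul c) = c;
  comul_counitr : forall c,
    tlift (fun (x : rmod coring_bimod) (y : coring_bimod) => bact x (counit y))
      (comul c) = c
}.

(* The product of the left dual convolution ring {}^*C, whose elements are the
   left linear maps C -> A: (f . g)(c) = sum f(c_(1) g(c_(2))). *)
Section Convolution.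
Variables (C : coring) (f g : {linear C -> A^o}).

Definition conv_fun (c : C) : A^o :=
  tlift (fun (x : rmod C) (y : C) => f (bact x (g y))) (comul C c).

Lemma conv_balanced :
  balanced (fun (x : rmod C) (y : C) => f (bact x (g y)) : A).
Proof.
split=> [x x' y|x y y'|x a y].
- by rewrite bactDl linearD.
- by rewrite linearD bactDr linearD.
- by rewrite linearZ -[RHS]/((f (bact x (a * (g y : A)))) : A) bactA.
Qed.

Lemma conv_linear : linear conv_fun.
Proof.
move=> a c d; rewrite /conv_fun linearP tliftD; last exact: conv_balanced.
congr (_ + _).
pose h t := tlift (fun (x : rmod C) (y : C) => f (bact x (g y)) : A) t.
have hD : {morph h : s t / s + t}.
  by move=> s t; apply: tliftD; exact: conv_balanced.
apply: (tensor_ext (f := fun t : tensor_bimod C C => h (a *: t))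
         (g := fun t => a * h t)) => [x y|x y|x y].
- by rewrite scalerDr; exact: hD.
- by rewrite hD mulrDr.
rewrite {1}/GRing.scale /= tensor_lact_pure /h.
do 2! (rewrite tlift_pure; last exact: conv_balanced).
by rewrite bactC linearZ.
Qed.
HB.instance Definition _ := GRing.isLinear.Build A C A^o *:%R conv_fun conv_linear.

Definition conv : {linear C -> A^o} := conv_fun.
End Convolution.

Record comodule (C : coring) := Comodule {
  comodule_mod :> rmodType A;
  coact : {linear comodule_mod -> tensor comodule_mod C};
  coact_coassoc : forall m,
    tassoc (tmap (M' := tensor comodule_mod C) coact idfun (coact m)) =
    tmap (M' := comodule_mod) idfun (comul C) (coact m);
  coact_counit : forall m,
    tlift (fun (m' : comodule_mod) (c : C) => m' ** (counit C c : A)) (coact m) = m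
}.

Record comodule_hom (C : coring) (M N : comodule C) := ComoduleHom {
  comodule_hom_map :> {linear M -> N};
  comodule_homE : forall m,
    coact N (comodule_hom_map m) =
    tmap (N' := C) comodule_hom_map idfun (coact M m)
}.

Record aring := ARing {
  aring_alg :> kalgebra K;
  aring_map : {rmorphism A -> aring_alg};
  aring_mapK : forall k, aring_map (kscal A k) = kscal aring_alg k
}.
End Coring.

(* Restriction of scalars along A -> B. *)
Definition restr (K : comPzRingType) (A : kalgebra K) (B : aring A)
  (M : rmodType B) : Type := M.

Section Restriction.
Variables (K : comPzRingType) (A : kalgebra K) (B : aring A) (M : rmodType B).
HB.instance Definition _ := GRing.Zmodule.on (restr M).
Definition restr_scale (a : A^c) (m : restr M) : restr M := (m : M) ** aring_map B a.
Let restr_scaleA a b m : restr_scale a (restr_scale b m) = restr_scale (a * b) m.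
Proof. by rewrite /restr_scale -rscaleA -rmorphM. Qed.
Let restr_scale1 m : restr_scale 1 m = m.
Proof. by rewrite /restr_scale rmorph1 rscale1. Qed.
Let restr_scaleDr : right_distributive restr_scale +%R.
Proof. by move=> a m n; exact: rscaleDl. Qed.
Let restr_scaleDl m : {morph restr_scale^~ m : a b / a + b}.
Proof. by move=> a b; rewrite /restr_scale rmorphD; exact: rscaleDr. Qed.
HB.instance Definition _ := GRing.Zmodule_isLmodule.Build A^c (restr M)
  restr_scaleA restr_scale1 restr_scaleDr restr_scaleDl.
End Restriction.

Notation right_regular B := (B^c^o).

Section Pairing.
Variables (K : comPzRingType) (A : kalgebra K) (C : coring A) (B : aring A).

Record pairing := Pairing {
  pair :> C -> B -> A;
  pairDl : forall c d b, pair (c + d) b = pair c b + pair d b;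
  pairDr : forall c b b', pair c (b + b') = pair c b + pair c b';
  pair_left : forall a c b, pair (a *: c) b = a * pair c b;
  pair_right : forall c b a, pair c (b * aring_map B a) = pair c b * a;
  pair_bal : forall c a b, pair (bact c a) b = pair c (aring_map B a * b)
}.

Section Beta.
Variables (p : pairing) (b : B).
Definition beta_fun (c : C) : A^o := p c b.
Let beta_linear : linear beta_fun.
Proof. by move=> a c d; rewrite /beta_fun pairDl pair_left. Qed.
HB.instance Definition _ :=
  GRing.isLinear.Build A C A^o *:%R beta_fun beta_linear.
Definition beta : {linear C -> A^o} := beta_fun.
End Beta.

Section Alpha.
Variables (p : pairing) (M : rmodType A) (t : tensor M C).
Definition alpha_fun (b : restr (right_regular B)) : M :=
  tlift (fun m c => m ** p c b) t.

Lemma alpha_balanced b : balanced (fun (m : M) (c : C) => m ** p c b).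
Proof.
split=> [m m' c|m c c'|m a c]; first exact: rscaleDl.
- by rewrite pairDl rscaleDr.
- by rewrite pair_left rscaleA.
Qed.

Let alpha_linear : linear alpha_fun.
Proof.
move=> a b b'.
have e (s : tensor M C) : tlift (fun m c => m ** p c (a *: b + b')) s =
    tlift (fun m c => m ** p c b) s ** a + tlift (fun m c => m ** p c b') s.
  apply: (tensor_ext (f := tlift (fun m c => m ** p c (a *: b + b')))
    (g := fun s => tlift (fun m c => m ** p c b) s ** a +
                   tlift (fun m c => m ** p c b') s)) => [x y|x y|m c].
  - by rewrite tliftD //; exact: alpha_balanced.
  - do 2! (rewrite tliftD; last exact: alpha_balanced).
    by rewrite rscaleDl addrACA.
  do 3! (rewrite tlift_pure; last exact: alpha_balanced).
  by rewrite pairDr pair_right rscaleDr rscaleA.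
exact: e.
Qed.
HB.instance Definition _ := GRing.isLinear.Build A^c
  (restr (right_regular B)) M *:%R alpha_fun alpha_linear.
Definition alpha : {linear restr (right_regular B) -> M} := alpha_fun.
End Alpha.

(* beta1 and betaM say that beta is a ring antihomomorphism; it is
   additive by pairDr. *)
Record rational_pairing := RationalPairing {
  rat_pairing :> pairing;
  beta1 : beta rat_pairing 1 = counit C;
  betaM : forall b b',
    beta rat_pairing (b * b') = conv (beta rat_pairing b') (beta rat_pairing b);
  alpha_inj : forall M : rmodType A, injective (@alpha rat_pairing M)
}.
End Pairing.

Section Rat.
Variables (K : comPzRingType) (A : kalgebra K) (C : coring A) (B : aring A).
Variable T : rational_pairing C B.

Definition rational (M : rmodType B) (m : M) : Prop :=
  exists s : seq (C * M), forall b,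
    m ** b = \sum_(p <- s) p.2 ** aring_map B (T p.1 b).

Lemma pairM c b b' (s : seq (C * C)) :
  comul C c = \sum_(p <- s) (p.1 : rmod C) \ox p.2 ->
  T c (b * b') = \sum_(p <- s) T (bact p.1 (T p.2 b)) b'.
Proof.
move=> cE; rewrite -[LHS]/(beta T (b * b') c) betaM.
rewrite -[LHS]/(conv_fun (beta T b') (beta T b) c) /conv_fun cE.
have bal := conv_balanced (beta T b') (beta T b).
elim: {cE} s => [|p s IHs]; first by rewrite !big_nil tlift0.
by rewrite !big_cons -IHs tliftD // tlift_pure.
Qed.

Section RatModule.
Variable M : rmodType B.

Lemma rational0 : rational (0 : M).
Proof. by exists [::] => b; rewrite big_nil rscale0l. Qed.

Lemma rationalD (m n : M) : rational m -> rational n -> rational (m + n).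
Proof.
move=> [s sE] [t tE]; exists (s ++ t) => b.
by rewrite big_cat /= rscaleDl sE tE.
Qed.

Lemma rationalM (m : M) b : rational m -> rational (m ** b).
Proof.
move=> [s sE]; suff [u uE] : exists u : seq (C * M), forall b',
    \sum_(p <- s) p.2 ** aring_map B (T p.1 (b * b')) =
    \sum_(p <- u) p.2 ** aring_map B (T p.1 b').
  by exists u => b'; rewrite -rscaleA sE uE.
elim: s {m sE} => [|[c m] s [u uE]]; first by exists [::] => b'; rewrite !big_nil.
have [w wE] := tensor_sum (comul C c : tensor (rmod C) C).
exists ([seq (bact (q.1 : C) (T q.2 b), m) | q <- w] ++ u) => b'.
rewrite big_cons big_cat uE big_map /= (pairM _ _ wE); congr (_ + _).
rewrite raddf_sum /=; elim: {wE} w => [|q w IHw]; first by rewrite !big_nil rscale0r.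
by rewrite !big_cons rscaleDr IHw.
Qed.

Definition ratp : {pred M} := fun m => `[< rational m >].
Let ratp_closed : submod_closed ratp.
Proof.
split=> [|b m n /asboolP rm /asboolP rn]; apply/asboolP; first exact: rational0.
by apply: rationalD => //; exact: rationalM.
Qed.
HB.instance Definition _ := GRing.isSubmodClosed.Build B^c M ratp ratp_closed.

Record Rat : Type := MkRat { rat_val : M; rat_valP : rat_val \in ratp }.
HB.instance Definition _ := [isSub for rat_val].
HB.instance Definition _ := [Choice of Rat by <:].
HB.instance Definition _ := [SubChoice_isSubLmodule of Rat by <:].
End RatModule.
Arguments ratp M m : clear implicits.

Section RatMap.
Variables (M N : rmodType B) (f : {linear M -> N}).
Lemma rational_map m : rational m -> rational (f m).
Proof.
move=> [s sE]; exists [seq (p.1, f p.2) | p <- s] => b.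
rewrite -rscale_linear sE big_map raddf_sum.
by apply: eq_bigr => p _; exact: rscale_linear.
Qed.

Lemma ratp_map (x : Rat M) : f (rat_val x) \in ratp N.
Proof. by apply/asboolP/rational_map/asboolP; exact: rat_valP. Qed.

Definition Rat_map_fun (x : Rat M) : Rat N := MkRat (ratp_map x).
Let Rat_map_linear : linear Rat_map_fun.
Proof. by move=> b x y; apply: val_inj; rewrite /= linearP. Qed.
HB.instance Definition _ :=
  GRing.isLinear.Build B^c (Rat M) (Rat N) *:%R Rat_map_fun Rat_map_linear.
Definition Rat_map : {linear Rat M -> Rat N} := Rat_map_fun.
End RatMap.

(* The two-sided ideal Rat(B_B) of B and its left action by B. *)
Definition rat_ideal : rmodType B := Rat (right_regular B).
Definition rat_incl (x : rat_ideal) : B := rat_val x.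

Lemma rat_ideal_lmul_subproof (b : B) (x : rat_ideal) :
  (b * rat_incl x : right_regular B) \in ratp (right_regular B).
Proof.
apply/asboolP; have /asboolP[s sE] := rat_valP x.
exists [seq (p.1, (b * p.2 : right_regular B)) | p <- s] => b'.
rewrite big_map /= -[LHS]/(b * rat_incl x * b') -mulrA.
rewrite -[rat_incl x * b']/(rat_val x ** b') sE mulr_sumr.
by apply: eq_bigr => p _; exact: (@mulrA B).
Qed.
Definition rat_ideal_lmul (b : B) (x : rat_ideal) : rat_ideal :=
  MkRat (rat_ideal_lmul_subproof b x).

(* Hom_B(Rat(B_B), N), a right B-module by (f b)(x) = f (b x). *)
Definition Hom_ideal (N : rmodType B) : Type := {linear rat_ideal -> N}.

Section HomIdeal.
Variable N : rmodType B.
HB.instance Definition _ := gen_eqMixin (Hom_ideal N).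
HB.instance Definition _ := gen_choiceMixin (Hom_ideal N).
Implicit Types f g : {linear rat_ideal -> N}.

Definition hom_ideal0 : Hom_ideal N := (\0 : {linear rat_ideal -> N}).
Definition hom_ideal_add (f g : Hom_ideal N) : Hom_ideal N :=
  ((f : {linear _ -> _}) \+ (g : {linear _ -> _}) : {linear rat_ideal -> N}).
Definition hom_ideal_opp (f : Hom_ideal N) : Hom_ideal N :=
  (\- (f : {linear _ -> _}) : {linear rat_ideal -> N}).
Let homDA : associative hom_ideal_add.
Proof. by move=> f g h; apply: linear_eq => x; exact: addrA. Qed.
Let homDC : commutative hom_ideal_add.
Proof. by move=> f g; apply: linear_eq => x; exact: addrC. Qed.
Let hom0D : left_id hom_ideal0 hom_ideal_add.
Proof. by move=> f; apply: linear_eq => x; exact: add0r. Qed.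
Let homND : left_inverse hom_ideal0 hom_ideal_opp hom_ideal_add.
Proof. by move=> f; apply: linear_eq => x; exact: addNr. Qed.
HB.instance Definition _ :=
  GRing.isZmodule.Build (Hom_ideal N) homDA homDC hom0D homND.

Section Scale.
Variables (b : B) (f : {linear rat_ideal -> N}).
Definition hom_ideal_act (x : rat_ideal) : N := f (rat_ideal_lmul b x).
Let hom_ideal_act_linear : linear hom_ideal_act.
Proof.
move=> a x y; rewrite /hom_ideal_act -linearP; congr (f _); apply: val_inj => /=.
by rewrite mulrDr mulrA.
Qed.
HB.instance Definition _ := GRing.isLinear.Build B^c rat_ideal N *:%R
  hom_ideal_act hom_ideal_act_linear.
End Scale.

Definition hom_ideal_scale (b : B^c) (f : Hom_ideal N) : Hom_ideal N :=
  (hom_ideal_act (b : B) (f : {linear _ -> _}) : {linear rat_ideal -> N}).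
Let hom_scaleA a b f : hom_ideal_scale a (hom_ideal_scale b f) = hom_ideal_scale (a * b) f.
Proof.
apply: linear_eq => x; congr ((f : {linear _ -> _}) _); apply: val_inj.
exact: (@mulrA B).
Qed.
Let hom_scale1 f : hom_ideal_scale 1 f = f.
Proof.
apply: linear_eq => x; congr ((f : {linear _ -> _}) _); apply: val_inj.
exact: (@mul1r B).
Qed.
Let hom_scaleDr : right_distributive hom_ideal_scale +%R.
Proof. by move=> a f g; apply: linear_eq. Qed.
Let hom_scaleDl f : {morph hom_ideal_scale^~ f : a b / a + b}.
Proof.
move=> a b; apply: linear_eq => x.
rewrite -[RHS](raddfD f); congr ((f : {linear _ -> _}) _); apply: val_inj.
exact: (@mulrDl B).
Qed.
HB.instance Definition _ := GRing.Zmodule_isLmodule.Build B^c (Hom_ideal N)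
  hom_scaleA hom_scale1 hom_scaleDr hom_scaleDl.
End HomIdeal.
End Rat.

Section ComoduleAction.
Variables (K : comPzRingType) (A : kalgebra K) (C : coring A) (B : aring A).
Variable T : rational_pairing C B.

(* The right B-module with m b = sum m_(0) <m_(1), b>. *)
Definition toB (S : rational_pairing C B) (M : comodule C) : Type := M.

Section Action.
Variable M : comodule C.
HB.instance Definition _ := GRing.Zmodule.on (toB T M).
Definition toB_scale (b : B^c) (m : toB T M) : toB T M := alpha T (coact M m) b.

Lemma alphaD (N : rmodType A) (s t : tensor N C) b :
  alpha T (s + t) b = alpha T s b + alpha T t b.
Proof. by apply: tliftD; exact: alpha_balanced. Qed.

Lemma alpha_pure (N : rmodType A) (n : N) (c : C) b :
  alpha T (n \ox c) b = n ** T c b.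
Proof. by apply: tlift_pure; exact: alpha_balanced. Qed.

Let toB_scaleDr : right_distributive toB_scale +%R.
Proof. by move=> b m n; rewrite /toB_scale raddfD alphaD. Qed.

Let toB_scaleDl m : {morph toB_scale^~ m : a b / a + b}.
Proof. by move=> a b; rewrite /toB_scale raddfD. Qed.

Let toB_scale1 m : toB_scale 1 m = m.
Proof.
rewrite /toB_scale -[RHS](coact_counit m).
rewrite -[LHS]/(tlift (fun n c => n ** T c 1) (coact M m)).
suff -> : (fun (n : M) c => n ** T c 1) = (fun n c => n ** (counit C c : A)) by [].
by apply/funext => n; apply/funext => c; rewrite -(beta1 T).
Qed.

Let toB_scaleA a b m : toB_scale a (toB_scale b m) = toB_scale (a * b) m.
Proof.
pose h := tlift (fun (n : M) (u : tensor_bimod C C) =>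
  n ** (tlift (fun (x : rmod C) (y : C) => T (bact x (T y b)) a) u : A)).
have bal := conv_balanced (beta T a) (beta T b).
pose phi (u : tensor_bimod C C) : A :=
  tlift (fun (x : rmod C) (y : C) => T (bact x (T y b)) a) u.
have phiD : {morph phi : u v / u + v} by move=> u v; exact: (tliftD _ _ bal).
have phi_pure x y : phi ((x : rmod C) \ox y) = T (bact x (T y b)) a.
  exact: (tlift_pure x y bal).
have phiA r u : phi (r *: u) = r * phi u.
  apply: (tensor_ext (f := fun u : tensor_bimod C C => phi (r *: u))
         (g := fun u => r * phi u)) => [x y|x y|x y].
  - by rewrite scalerDr; exact: phiD.
  - by rewrite phiD mulrDr.
  rewrite {1}/GRing.scale /= tensor_lact_pure !phi_pure.
  by rewrite bactC pair_left.
have hbal : balanced (fun (n : M) (u : tensor_bimod C C) => n ** phi u).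
  split=> [n n' u|n u v|n r u]; first exact: rscaleDl.
  - by rewrite phiD rscaleDr.
  - by rewrite phiA rscaleA.
have hD : {morph h : u v / u + v} by move=> u v; exact: tliftD.
have h_pure n u : h (n \ox u) = n ** phi u by exact: tlift_pure.
have tmap1D : {morph tmap (M' := M) idfun (comul C) :
    x y / (x : tensor M C) + y >-> x + y}.
  by apply: tmapD => // *; [exact: linearD | exact: linearZ].
have tmap2D : {morph tmap (M' := tensor M C) (coact M) idfun :
    x y / (x : tensor M C) + y >-> x + y}.
  by apply: tmapD => // *; [exact: linearD | exact: rscale_linear].
have tmap1_pure (n : M) (c : C) :
    tmap (M' := M) idfun (comul C) (n \ox c) = n \ox comul C c.
  by apply: tmap_pure => // *; [exact: linearD | exact: linearZ].
have tmap2_pure (n : M) (c : C) :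
    tmap (M' := tensor M C) (coact M) idfun (n \ox c) = coact M n \ox c.
  by apply: tmap_pure => // *; [exact: linearD | exact: rscale_linear].
have lhs (t : tensor M C) :
    h (tassoc (tmap (M' := tensor M C) (coact M) idfun t)) =
    toB_scale a (alpha T t b).
  apply: (tensor_ext
    (f := fun t => h (tassoc (tmap (M' := tensor M C) (coact M) idfun t)))
    (g := fun t => toB_scale a (alpha T t b))) => [x y|x y|n c].
  - by rewrite tmap2D tassocD hD.
  - by rewrite alphaD toB_scaleDr.
  rewrite tmap2_pure alpha_pure /toB_scale rscale_linear.
  apply: (tensor_ext
    (f := fun t : tensor M C => h (tassoc (t \ox c)))
    (g := fun t : tensor M C => alpha T (t ** T c b) a)) => [x y|x y|n' d].
  - by rewrite pureDl tassocD hD.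
  - by rewrite rscaleDl alphaD.
  rewrite tassoc_pure h_pure phi_pure.
  by rewrite [in RHS]/rscale [in RHS]/GRing.scale /= tensor_ract_pure alpha_pure.
have rhs (t : tensor M C) :
    h (tmap (M' := M) idfun (comul C) t) = alpha T t (a * b).
  apply: (tensor_ext
    (f := fun t => h (tmap (M' := M) idfun (comul C) t))
    (g := fun t => alpha T t (a * b))) => [x y|x y|n c].
  - by rewrite tmap1D hD.
  - exact: alphaD.
  rewrite tmap1_pure h_pure alpha_pure; congr (_ ** _).
  by rewrite -[RHS]/(beta T ((b : B) * (a : B)) c) betaM.
by rewrite -[RHS]/(alpha T (coact M m) (a * b)) -rhs -coact_coassoc lhs.
Qed.

HB.instance Definition _ := GRing.Zmodule_isLmodule.Build B^c (toB T M)
  toB_scaleA toB_scale1 toB_scaleDr toB_scaleDl.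
End Action.

Section Hom.
Variables (M N : comodule C) (f : comodule_hom M N).
Definition toB_hom_fun (m : toB T M) : toB T N := f m.
Let toB_hom_linear : linear toB_hom_fun.
Proof.
have fZ b m : toB_hom_fun (b *: m) = b *: toB_hom_fun m.
  rewrite -[RHS]/(alpha T (coact N (f m)) b) comodule_homE.
  rewrite -[LHS]/(f (alpha T (coact M m) b)).
  apply: (tensor_ext (f := fun t : tensor M C => f (alpha T t b))
    (g := fun t => alpha T (tmap (N' := C) f idfun t) b)) => [x y|x y|n c].
  - by rewrite alphaD linearD.
  - have -> : tmap (N' := C) f idfun (x + y) =
        tmap (N' := C) f idfun x + tmap (N' := C) f idfun y.
      by apply: tmapD => // *; [exact: linearD | exact: rscale_linear].
    exact: alphaD.
  - have -> : tmap (N' := C) f idfun (n \ox c) = f n \ox c.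
      by apply: tmap_pure => // *; [exact: linearD | exact: rscale_linear].
    by rewrite !alpha_pure rscale_linear.
by move=> b m n; rewrite -fZ; exact: linearD.
Qed.
HB.instance Definition _ := GRing.isLinear.Build B^c (toB T M) (toB T N) *:%R
  toB_hom_fun toB_hom_linear.
Definition toB_hom : {linear toB T M -> toB T N} := toB_hom_fun.
End Hom.

(* zeta_M(m)(a) = m a, where m a : M is mapped into E by j. *)
Section Zeta.
Variables (M E : comodule C) (j : comodule_hom M E).

Section ZetaFun.
Variable m : toB T M.
Definition zeta_fun (x : rat_ideal T) : toB T E := toB_hom j (m ** rat_incl x).
Let zeta_fun_linear : linear zeta_fun.
Proof.
move=> b x y; rewrite -linearP; congr (toB_hom j _).
rewrite -[b *: (m ** _)]/(m ** rat_incl x ** b) -rscaleA -rscaleDr.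
by congr (m ** _).
Qed.
HB.instance Definition _ := GRing.isLinear.Build B^c (rat_ideal T) (toB T E) *:%R
  zeta_fun zeta_fun_linear.
End ZetaFun.

Definition zeta_map (m : toB T M) : Hom_ideal T (toB T E) :=
  (zeta_fun m : {linear rat_ideal T -> toB T E}).
Let zeta_map_linear : linear zeta_map.
Proof.
move=> b m n; apply: linear_eq => x.
rewrite -[RHS]/(zeta_fun m (rat_ideal_lmul b x) + zeta_fun n x).
rewrite /zeta_fun -linearD.
congr (toB_hom j _); rewrite rscaleDl; congr (_ + _).
by rewrite -[b *: m]/(m ** b) -rscaleA.
Qed.
HB.instance Definition _ := GRing.isLinear.Build B^c (toB T M)
  (Hom_ideal T (toB T E)) *:%R zeta_map zeta_map_linear.
Definition zeta : {linear toB T M -> Hom_ideal T (toB T E)} := zeta_map.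
End Zeta.
End ComoduleAction.

Record category := Category {
  obj :> Type;
  hom : obj -> obj -> Type;
  idmor : forall X, hom X X;
  comp : forall X Y Z, hom Y Z -> hom X Y -> hom X Z;
  comp_idl : forall X Y (f : hom X Y), comp (idmor Y) f = f;
  comp_idr : forall X Y (f : hom X Y), comp f (idmor X) = f;
  compA : forall X Y Z W (f : hom Z W) (g : hom Y Z) (h : hom X Y),
    comp f (comp g h) = comp (comp f g) h
}.
Arguments hom {c} X Y.
Arguments idmor {c} X.
Arguments comp {c X Y Z} f g.

Section CategoryNotions.
Variable X : category.

Definition mono (x y : X) (f : hom x y) : Prop :=
  forall z (g h : hom z x), comp f g = comp f h -> g = h.

Definition is_iso (x y : X) (f : hom x y) : Prop :=
  exists g : hom y x, comp g f = idmor x /\ comp f g = idmor y.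

Definition injective_object (q : X) : Prop :=
  forall (x y : X) (i : hom x y) (f : hom x q), mono i ->
  exists g : hom y q, comp g i = f.

Definition essential_mono (x y : X) (i : hom x y) : Prop :=
  mono i /\ forall z (g : hom y z), mono (comp g i) -> mono g.

Definition injective_envelope (x e : X) (i : hom x e) : Prop :=
  injective_object e /\ essential_mono i.
End CategoryNotions.
Arguments is_iso X {x y} f.
Arguments injective_object X q : clear implicits.
Arguments injective_envelope X {x e} i.

Record functor (X Y : category) := Functor {
  fobj :> X -> Y;
  fmap : forall x y, hom x y -> hom (fobj x) (fobj y);
  fmap_id : forall x, fmap (idmor x) = idmor (fobj x);
  fmap_comp : forall x y z (f : hom y z) (g : hom x y),
    fmap (comp f g) = comp (fmap f) (fmap g)
}.
Arguments fmap {X Y} _ {x y} _.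

Section ModuleCategory.
Variable R : pzRingType.
Definition mod_id (M : rmodType R) : {linear M -> M} := idfun.
Definition mod_comp (M N P : rmodType R) (f : {linear N -> P}) (g : {linear M -> N}) :
  {linear M -> P} := f \o g.
Let compl_idl (M N : rmodType R) (f : {linear M -> N}) : mod_comp (mod_id N) f = f.
Proof. exact: linear_eq. Qed.
Let compl_idr (M N : rmodType R) (f : {linear M -> N}) : mod_comp f (mod_id M) = f.
Proof. exact: linear_eq. Qed.
Let complA (M N P Q : rmodType R) (f : {linear P -> Q}) (g : {linear N -> P})
  (h : {linear M -> N}) : mod_comp f (mod_comp g h) = mod_comp (mod_comp f g) h.
Proof. exact: linear_eq. Qed.

Definition RMod : category :=
  Category (hom := fun M N : rmodType R => {linear M -> N})
    compl_idl compl_idr complA.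
End ModuleCategory.

Section ComoduleCategory.
Variables (K : comPzRingType) (A : kalgebra K) (C : coring A).

Lemma comodule_hom_eq (M N : comodule C) (f g : comodule_hom M N) :
  f =1 g -> f = g.
Proof.
case: f g => [f fE] [g gE] /= /linear_eq fg; subst g.
by congr ComoduleHom; exact: Prop_irrelevance.
Qed.

Let idc_subproof (M : comodule C) m : coact M m =
  tmap (M' := M) (N' := C) (idfun : {linear M -> M}) idfun (coact M m).
Proof.
apply: (tensor_ext (f := id)
  (g := tmap (M' := M) (N' := C) (idfun : {linear M -> M}) idfun)) => //.
- exact: tmapD.
- by move=> n c; rewrite tmap_pure.
Qed.
Definition comod_id (M : comodule C) : comodule_hom M M :=
  ComoduleHom (comodule_hom_map := idfun) (@idc_subproof M).

Let compc_subproof (M N P : comodule C) (f : comodule_hom N P)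
  (g : comodule_hom M N) m :
  coact P ((f \o g : {linear M -> P}) m) =
  tmap (N' := C) (f \o g : {linear M -> P}) idfun (coact M m).
Proof.
rewrite /= comodule_homE comodule_homE.
have tmapfD (Q Q' : rmodType A) (h : {linear Q -> Q'}) :
    {morph tmap (N' := C) h idfun : x y / (x : tensor Q C) + y >-> x + y}.
  by apply: tmapD => // *; [exact: linearD | exact: rscale_linear].
have tmapf_pure (Q Q' : rmodType A) (h : {linear Q -> Q'}) q (c : C) :
    tmap (N' := C) h idfun (q \ox c) = h q \ox c.
  by apply: tmap_pure => // *; [exact: linearD | exact: rscale_linear].
apply: (tensor_ext
  (f := fun t : tensor M C => tmap (N' := C) f idfun (tmap (N' := C) g idfun t))
  (g := tmap (N' := C) (f \o g : {linear M -> P}) idfun)) => [x y|x y|n c].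
- by rewrite !tmapfD.
- exact: tmapfD.
- by rewrite !tmapf_pure.
Qed.
Definition comod_comp (M N P : comodule C)
  (f : comodule_hom N P) (g : comodule_hom M N) :
  comodule_hom M P :=
  ComoduleHom (comodule_hom_map := f \o g) (compc_subproof f g).
Let compc_idl M N (f : comodule_hom M N) : comod_comp (comod_id N) f = f.
Proof. exact: comodule_hom_eq. Qed.
Let compc_idr M N (f : comodule_hom M N) : comod_comp f (comod_id M) = f.
Proof. exact: comodule_hom_eq. Qed.
Let compcA M N P Q (f : comodule_hom P Q) (g : comodule_hom N P)
  (h : comodule_hom M N) : comod_comp f (comod_comp g h) = comod_comp (comod_comp f g) h.
Proof. exact: comodule_hom_eq. Qed.

Definition Comod : category :=
  Category (hom := @comodule_hom K A C) compc_idl compc_idr compcA.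
End ComoduleCategory.

Section RatFunctor.
Variables (K : comPzRingType) (A : kalgebra K) (C : coring A) (B : aring A).
Variable T : rational_pairing C B.
Definition Rat_obj (M : RMod B) : RMod B := Rat T (M : rmodType B).
Definition Rat_hom (M N : RMod B) (f : hom M N) : hom (Rat_obj M) (Rat_obj N) :=
  Rat_map T (f : {linear _ -> _}).
Let ratF_id (M : RMod B) : Rat_hom (idmor M) = idmor (Rat_obj M).
Proof. by apply: linear_eq => x; apply: val_inj. Qed.
Let ratF_comp (M N P : RMod B) (f : hom N P) (g : hom M N) :
  Rat_hom (comp f g) = comp (Rat_hom f) (Rat_hom g).
Proof. by apply: linear_eq => x; apply: val_inj. Qed.

Definition Rat_functor : functor (RMod B) (RMod B) := Functor ratF_id ratF_comp.
End RatFunctor.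

Definition short_exact (R : pzRingType) (X Y Z : rmodType R)
    (f : {linear X -> Y}) (g : {linear Y -> Z}) : Prop :=
  [/\ injective f, forall y, g y = 0 <-> exists x, f x = y
    & forall z, exists y, g y = z].

Definition exact_functor (R S : pzRingType) (F : functor (RMod R) (RMod S)) :
  Prop :=
  forall (X Y Z : rmodType R) (f : {linear X -> Y}) (g : {linear Y -> Z}),
    short_exact f g ->
    short_exact (fmap F (f : hom (X : RMod R) Y))
                (fmap F (g : hom (Y : RMod R) Z)).

Definition flat (R : pzRingType) (N : lmodType R) : Prop :=
  forall (X Y : rmodType R) (f : {linear X -> Y}), injective f ->
    injective (tmap f idfun : tensor X N -> tensor Y N).

Section LeftModuleAring.
Variables (K : comPzRingType) (A : kalgebra K) (B : aring A).
Definition aring_left : Type := aring_alg B.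
HB.instance Definition _ := GRing.Zmodule.on aring_left.
Definition aring_left_scale (a : A) (b : aring_left) : aring_left :=
  aring_map B a * (b : B).
Let lscaleA a b x : aring_left_scale a (aring_left_scale b x) = aring_left_scale (a * b) x.
Proof. by rewrite /aring_left_scale mulrA rmorphM. Qed.
Let lscale1 x : aring_left_scale 1 x = x.
Proof. by rewrite /aring_left_scale rmorph1 mul1r. Qed.
Let lscaleDr : right_distributive aring_left_scale +%R.
Proof. by move=> a x y; exact: mulrDr. Qed.
Let lscaleDl x : {morph aring_left_scale^~ x : a b / a + b}.
Proof. by move=> a b; rewrite /aring_left_scale rmorphD; exact: mulrDl. Qed.
HB.instance Definition _ := GRing.Zmodule_isLmodule.Build A aring_left
  lscaleA lscale1 lscaleDr lscaleDl.
End LeftModuleAring.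

(* I is the membership predicate of the ideal, L that of the set of local units. *)
Definition local_units (R : pzRingType) (I : R -> Prop) (L : R -> Prop) : Prop :=
  [/\ forall e, L e -> I e,
      forall e, L e -> e * e = e,
      forall e f, L e -> L f -> e * f = f * e
    & forall x, I x -> exists e, [/\ L e, x * e = x & e * x = x]].

Definition finite_support (R : pzRingType) (L : R -> Prop) (M : rmodType R) :
  Prop :=
  exists F : seq R, [/\ uniq F, forall e, e \in F -> L e
    & forall m : M, m ** (\sum_(e <- F) e) = m].

(* Main.v *)
(* If [Rat] is exact then [n] in [n a] for every rational element [n] of a
   [B]-module [N]: lift [n] along [B -> n B] to an element of [a = Rat(B)]. Hence a
   rational [h : a -> E] satisfies [h = h u] for some [u] in [a], so
   [h = zeta (h u)] and zeta identifies a comodule [E] with [Rat(Hom_B(a, E))].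
   As [Rat N] is a comodule (the coaction is forced by injectivity of alpha), this
   gives [Hom_B(N, Hom_B(a, E)) = Hom(Rat N, E)], whence injectivity of
   [Hom_B(a, E)] when [E] is injective. Essentiality follows from
   [h x = zeta (h(x))] for [x] in [a]: a nonzero submodule of [Hom_B(a, E)] meets
   the image of [E]. Under finite support with [s] the sum of the given units,
   [h = zeta (h s)], and flatness of [B] makes restriction along [A -> B] right
   adjoint to an exact functor. *)
From HB Require Import structures.
From mathcomp Require Import all_boot all_algebra generic_quotient ring_quotient boolp.
Require Import Defs.

Set Implicit Arguments.
Unset Strict Implicit.
Unset Printing Implicit Defensive.

Import GRing.Theory.
Local Open Scope ring_scope.

(** * Kernel, range and cokernel of a linear map *)

Section LinearMapFactorization.
Variables (R : pzRingType) (X Y : lmodType R) (f : {linear X -> Y}).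

Definition kernel_pred : {pred X} := fun x => f x == 0.
Lemma kernel_closed : submod_closed kernel_pred.
Proof.
split=> [|a x y /eqP x0 /eqP y0]; first exact/eqP/linear0.
by rewrite -topredE /= /kernel_pred linearP x0 y0 scaler0 addr0.
Qed.
HB.instance Definition _ :=
  GRing.isSubmodClosed.Build R X kernel_pred kernel_closed.
Record kernel : Type := Kernel { kernel_val : X; _ : kernel_val \in kernel_pred }.
HB.instance Definition _ := [isSub for kernel_val].
HB.instance Definition _ := [Choice of kernel by <:].
HB.instance Definition _ := [SubChoice_isSubLmodule of kernel by <:].

Definition range_pred : {pred Y} := fun y => `[< exists x, f x = y >].
Lemma range_closed : submod_closed range_pred.
Proof.
split=> [|a _ _ /asboolP[x <-] /asboolP[y <-]]; apply/asboolP.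
  by exists 0; rewrite linear0.
by exists (a *: x + y); rewrite linearP.
Qed.
HB.instance Definition _ :=
  GRing.isSubmodClosed.Build R Y range_pred range_closed.
Record range : Type := Range { range_val : Y; _ : range_val \in range_pred }.
HB.instance Definition _ := [isSub for range_val].
HB.instance Definition _ := [Choice of range by <:].
HB.instance Definition _ := [SubChoice_isSubLmodule of range by <:].

Lemma range_subproof x : f x \in range_pred.
Proof. by apply/asboolP; exists x. Qed.
Definition corestr x : range := Range (range_subproof x).
Lemma corestr_linear : linear corestr.
Proof. by move=> a x y; apply: val_inj; rewrite /= linearP. Qed.
HB.instance Definition _ :=
  GRing.isLinear.Build R X range *:%R corestr corestr_linear.

Lemma range_zmod_closed : zmod_closed range_pred.
Proof. by split=> [|x y]; [exact: rpred0 | exact: rpredB]. Qed.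
HB.instance Definition _ :=
  GRing.isZmodClosed.Build Y range_pred range_zmod_closed.
(** The quotient is formed additively; scalars then act through representatives, which is consistent
    because the range is stable under scaling. *)
Definition coker : Type := Quotient.quot range_pred.
HB.instance Definition _ := GRing.Zmodule.on coker.
Definition coker_pi (y : Y) : coker := (\pi_(Quotient.quot range_pred) y)%qT.

Lemma coker_piE x y : (coker_pi x == coker_pi y) = (x - y \in range_pred).
Proof. exact/esym/Quotient.idealrBE. Qed.
Lemma coker_piD : {morph coker_pi : x y / x + y}.
Proof. by move=> x y; rewrite /coker_pi !piE. Qed.
Lemma coker_piP u : exists y, coker_pi y = u.
Proof. by exists (repr (u : Quotient.quot range_pred)); exact: reprK. Qed.

Definition coker_scale (a : R) (u : coker) : coker :=
  coker_pi (a *: repr (u : Quotient.quot range_pred)).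
Lemma coker_scale_pi a y : coker_scale a (coker_pi y) = coker_pi (a *: y).
Proof.
apply/eqP; rewrite coker_piE -scalerBr; apply: rpredZ.
by rewrite -coker_piE; apply/eqP; exact: reprK.
Qed.

Let coker_scaleA a b u : coker_scale a (coker_scale b u) = coker_scale (a * b) u.
Proof. by have [y <-] := coker_piP u; rewrite !coker_scale_pi scalerA. Qed.
Let coker_scale1 u : coker_scale 1 u = u.
Proof. by have [y <-] := coker_piP u; rewrite !coker_scale_pi scale1r. Qed.
Let coker_scaleDr : right_distributive coker_scale +%R.
Proof.
move=> a u v; have [x <-] := coker_piP u; have [y <-] := coker_piP v.
by rewrite !(coker_scale_pi, =^~ coker_piD) scalerDr.
Qed.
Let coker_scaleDl u : {morph coker_scale^~ u : a b / a + b}.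
Proof.
move=> a b; have [x <-] := coker_piP u.
by rewrite !(coker_scale_pi, =^~ coker_piD) scalerDl.
Qed.
HB.instance Definition _ := GRing.Zmodule_isLmodule.Build R coker
  coker_scaleA coker_scale1 coker_scaleDr coker_scaleDl.

Let coker_pi_linear : linear coker_pi.
Proof. by move=> a x y; rewrite coker_piD -coker_scale_pi. Qed.
HB.instance Definition _ :=
  GRing.isLinear.Build R Y coker *:%R coker_pi coker_pi_linear.
End LinearMapFactorization.

Section Action.
Variables (R : pzRingType) (N : rmodType R) (n : N).
Definition act (b : right_regular R) : N := n ** b.
Let act_linear : linear act.
Proof. by move=> a b b'; rewrite /act rscaleDr; congr (_ + _); exact: rscaleA. Qed.
HB.instance Definition _ :=
  GRing.isLinear.Build R^c (right_regular R) N *:%R act act_linear.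
End Action.

(** * Rational elements when Rat is exact *)

Section ExactRat.
Variables (K : comPzRingType) (A : kalgebra K) (C : coring A) (B : aring A).
Variables (T : rational_pairing C B).
Hypothesis Rat_exact : exact_functor (Rat_functor T).

Lemma RatP (M : rmodType B) (m : M) : rational T m -> exists x : Rat T M, \val x = m.
Proof. by move=> mr; exists (MkRat (introT (asboolP _) mr)). Qed.

Lemma Rat_rational (M : rmodType B) (x : Rat T M) : rational T (\val x).
Proof. exact/asboolP/(rat_valP x). Qed.

(** Exactness of Rat concerns short exact sequences, so an arbitrary map is cut into two of them,
    meeting at its range. *)
Lemma range_short_exact (X Y : rmodType B) (f : {linear X -> Y}) :
  short_exact (\val : {linear range f -> Y}) (@coker_pi _ _ _ f).
Proof.
split=> [|y|u]; first exact: val_inj; last exact: coker_piP.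
have -> : (coker_pi f y = 0) <-> y \in range_pred f.
  rewrite -(linear0 (@coker_pi _ _ _ f)); split=> [/eqP|yr]; last apply/eqP.
    by rewrite coker_piE subr0.
  by rewrite coker_piE subr0.
by split=> [yr|[[x xr] <-]]; [exists (Range yr) | ].
Qed.

Lemma kernel_short_exact (X Y : rmodType B) (f : {linear X -> Y}) :
  short_exact (\val : {linear kernel f -> X}) (@corestr _ _ _ f).
Proof.
split=> [|x|[y yr]]; first exact: val_inj; last first.
  by have /asboolP[x xE] := yr; exists x; apply: val_inj.
split=> [/(congr1 val)/= /eqP x0|[[x' x0] <-]]; last exact/val_inj/eqP.
by exists (Kernel (x0 : x \in kernel_pred f)).
Qed.

Lemma rational_lift (X Y : rmodType B) (f : {linear X -> Y}) (x : X) :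
  rational T (f x) -> exists2 x', rational T x' & f x' = f x.
Proof.
move=> /RatP[y yE].
(* Exactness in the middle: a rational element killed in the cokernel is already rational inside the
   range. *)
have [_ /(_ y) [+ _] _] := Rat_exact (range_short_exact f).
case.
  apply: val_inj; rewrite /= yE; apply/eqP.
  by rewrite -(linear0 (@coker_pi _ _ _ f)) coker_piE subr0 range_subproof.
move=> z /(congr1 val)/=; rewrite yE => zE.
(* Rat keeps the corestriction surjective, so [z] lifts to [Rat T X]. *)
have [_ _ /(_ z)[x' /(congr1 val)/(congr1 val)/= x'E]] :=
  Rat_exact (kernel_short_exact f).
by exists (\val x'); [exact: Rat_rational | rewrite x'E].
Qed.

Lemma rational_inj (X Y : rmodType B) (f : {linear X -> Y}) (x : X) :
  injective f -> rational T (f x) -> rational T x.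
Proof. by move=> fI /rational_lift[x' xr /fI <-]. Qed.

(** Idempotence of Rat: the elements witnessing rationality can be taken inside [Rat T N], not
    merely in [N]. *)
Lemma Rat_all_rational (N : rmodType B) (x : Rat T N) : rational T x.
Proof. exact: (rational_inj (f := \val) val_inj (Rat_rational x)). Qed.

(** Since [n] is the image of [1] under [act n], any rational preimage [u] satisfies
    [n ** u = n]. *)
Lemma rational_local_unit (N : rmodType B) (n : N) :
  rational T n -> exists u : rat_ideal T, n ** rat_incl u = n.
Proof.
move=> nr; have [|u /RatP[v <-]] := @rational_lift _ _ (act n) 1.
  by rewrite /= /act rscale1.
by rewrite /= /act rscale1; exists v.
Qed.
End ExactRat.

(** * The iterated pairing on the triple tensor product separates points *)

Section Bialpha.
Variables (K : comPzRingType) (A : kalgebra K) (C : coring A) (B : aring A).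
Variables (T : rational_pairing C B) (M : rmodType A).

(** Lets equations be moved to the other bracketing, where injectivity of alpha can be applied
    twice. *)
Lemma tassoc_surj (C1 C2 : bimod A) (u : tensor M (tensor_bimod C1 C2)) :
  exists t : tensor (tensor M C1) C2, tassoc t = u.
Proof.
have tassoc0 : @tassoc _ _ M C1 C2 0 = 0.
  by apply: (addrI (@tassoc _ _ M C1 C2 0)); rewrite -tassocD !addr0.
elim/tensor_ind: u => [|m v|u v [s <-] [t <-]]; first by exists 0.
  have [s ->] := tensor_sum (v : tensor (rmod C1) C2).
  elim: s => [|p s [t tE]].
    by rewrite big_nil; exists 0; rewrite tassoc0; exact/esym/(@pure0r _ _ (tensor_bimod C1 C2) m).
  exists (((m \ox (p.1 : C1)) : tensor M C1) \ox p.2 + t).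
  rewrite tassocD tassoc_pure tE big_cons.
  exact/esym/(@pureDr _ _ (tensor_bimod C1 C2) m).
by exists (s + t); rewrite tassocD.
Qed.

(* The functional [m (x) (c (x) d) |-> m <c <d, b>, b'>] on [M (x) (C (x) C)]. *)
Definition bialpha (b b' : B) (u : tensor M (tensor_bimod C C)) : M :=
  tlift (fun (m : M) (v : tensor_bimod C C) =>
    m ** (tlift (fun (x : rmod C) (y : C) => T (bact x (T y b)) b') v : A)) u.

Let phi (b b' : B) (v : tensor_bimod C C) : A :=
  tlift (fun (x : rmod C) (y : C) => T (bact x (T y b)) b') v.

Let phiD b b' : {morph phi b b' : u v / u + v}.
Proof. by move=> u v; exact: (tliftD _ _ (conv_balanced (beta T b') (beta T b))). Qed.

Let phi_pure b b' x y : phi b b' ((x : rmod C) \ox y) = T (bact x (T y b)) b'.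
Proof. exact: (tlift_pure x y (conv_balanced (beta T b') (beta T b))). Qed.

Let phiZ b b' a v : phi b b' (a *: v) = a * phi b b' v.
Proof.
apply: (tensor_ext (f := fun v : tensor_bimod C C => phi b b' (a *: v))
       (g := fun v => a * phi b b' v)) => [x y|x y|x y].
- by rewrite scalerDr; exact: phiD.
- by rewrite phiD mulrDr.
by rewrite {1}/GRing.scale /= tensor_lact_pure !phi_pure bactC pair_left.
Qed.

Let phi_balanced b b' :
  balanced (fun (m : M) (v : tensor_bimod C C) => m ** phi b b' v).
Proof.
split=> [m m' v|m v v'|m a v]; first exact: rscaleDl.
- by rewrite phiD rscaleDr.
- by rewrite phiZ rscaleA.
Qed.

Lemma bialphaD b b' : {morph bialpha b b' : u v / u + v}.
Proof. by move=> u v; exact: (tliftD _ _ (phi_balanced b b')). Qed.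

Lemma bialpha_pure b b' m c d :
  bialpha b b' (m \ox (((c : rmod C) \ox d) : tensor_bimod C C)) =
  m ** T (bact c (T d b)) b'.
Proof. by rewrite /bialpha (tlift_pure _ _ (phi_balanced b b')) phi_pure. Qed.

Lemma alpha_rscale (t : tensor M C) a b :
  alpha T (t ** a) b = alpha T t (aring_map B a * b).
Proof.
apply: (tensor_ext (f := fun t : tensor M C => alpha T (t ** a) b)
  (g := fun t => alpha T t (aring_map B a * b))) => [x y|x y|m c].
- by rewrite rscaleDl alphaD.
- exact: alphaD.
by rewrite [in LHS]/rscale [in LHS]/GRing.scale /= tensor_ract_pure !alpha_pure pair_bal.
Qed.

(** The inner [alpha] pairs [b] with the last factor, and the resulting scalar is absorbed into the
    remaining [C] by [pair_bal]. *)
Lemma bialpha_tassoc b b' (t : tensor (tensor M C) C) :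
  bialpha b b' (tassoc t) = alpha T (alpha T t b) b'.
Proof.
apply: (tensor_ext (f := fun t => bialpha b b' (tassoc t))
  (g := fun t : tensor (tensor M C) C => alpha T (alpha T t b) b'))
  => [x y|x y|s d].
- by rewrite tassocD bialphaD.
- by rewrite !alphaD.
apply: (tensor_ext (f := fun s : tensor M C => bialpha b b' (tassoc (s \ox d)))
  (g := fun s : tensor M C => alpha T (alpha T (s \ox d) b) b'))
  => [x y|x y|m c].
- by rewrite pureDl tassocD bialphaD.
- by rewrite pureDl !alphaD.
rewrite tassoc_pure bialpha_pure alpha_pure alpha_rscale alpha_pure.
by rewrite pair_bal.
Qed.

(** This is antimultiplicativity of beta, spread over [M]. *)
Lemma bialpha_comul b b' (t : tensor M C) :
  bialpha b b' (tmap (M' := M) idfun (comul C) t) = alpha T t (b * b').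
Proof.
have tmapidD : {morph tmap (M' := M) idfun (comul C) :
    x y / (x : tensor M C) + y >-> x + y}.
  by apply: tmapD => // *; [exact: linearD | exact: linearZ].
apply: (tensor_ext
  (f := fun t => bialpha b b' (tmap (M' := M) idfun (comul C) t))
  (g := fun t : tensor M C => alpha T t (b * b'))) => [x y|x y|m c].
- by rewrite tmapidD bialphaD.
- exact: alphaD.
have -> : tmap (M' := M) idfun (comul C) (m \ox c) = m \ox comul C c.
  by apply: tmap_pure => // *; [exact: linearD | exact: linearZ].
rewrite /bialpha (tlift_pure _ _ (phi_balanced b b')) alpha_pure; congr (_ ** _).
by rewrite -[RHS]/(beta T (b * b') c) betaM.
Qed.

Lemma bialpha_inj (u v : tensor M (tensor_bimod C C)) :
  (forall b b', bialpha b b' u = bialpha b b' v) -> u = v.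
Proof.
have [s <-] := tassoc_surj u; have [t <-] := tassoc_surj v => uv.
congr tassoc; apply: (@alpha_inj _ _ _ _ T); apply: linear_eq => b.
apply: (@alpha_inj _ _ _ _ T); apply: linear_eq => b'.
rewrite -!bialpha_tassoc; exact: uv.
Qed.
End Bialpha.

Section AlphaMap.
Variables (K : comPzRingType) (A : kalgebra K) (C : coring A) (B : aring A).
Variables (T : rational_pairing C B).

Lemma alpha_tmap (M N : rmodType A) (f : M -> N) (t : tensor M C) b :
  {morph f : x y / x + y} -> (forall m a, f (m ** a) = f m ** a) ->
  alpha T (tmap (N' := C) f idfun t) b = f (alpha T t b).
Proof.
move=> fD fA.
apply: (tensor_ext (f := fun t => alpha T (tmap (N' := C) f idfun t) b)
  (g := fun t => f (alpha T t b))) => [x y|x y|m c].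
- by rewrite tmapD // alphaD.
- by rewrite alphaD fD.
by rewrite tmap_pure // !alpha_pure fA.
Qed.
End AlphaMap.

(** * Rational modules are comodules *)

Section RationalComodule.
Variables (K : comPzRingType) (A : kalgebra K) (C : coring A) (B : aring A).
Variables (T : rational_pairing C B) (M : rmodType B).
Hypothesis M_rational : forall m : M, rational T m.

(** The tensor is obtained by choice, but injectivity of alpha makes it unique; linearity and the
    comodule axioms follow from this. *)
Lemma rat_coact_subproof (m : M) :
  {t : tensor (restr M) C | forall b, alpha T t b = m ** b}.
Proof.
apply: cid; have [s sE] := M_rational m.
exists (\sum_(p <- s) (p.2 : restr M) \ox p.1) => b; rewrite sE.
elim: {sE} s => [|p s IHs]; last by rewrite !big_cons alphaD alpha_pure IHs.
by rewrite !big_nil; apply: (addrI (alpha T (0 : tensor (restr M) C) b));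
  rewrite -alphaD !addr0.
Qed.
Definition rat_coact (m : restr M) : tensor (restr M) C := sval (rat_coact_subproof m).

Lemma alpha_rat_coact (m : M) (b : B) : alpha T (rat_coact m) b = m ** b.
Proof. exact: (svalP (rat_coact_subproof m)). Qed.

Let rat_coact_linear : linear rat_coact.
Proof.
move=> a m n; apply: (@alpha_inj _ _ _ _ T); apply: linear_eq => b.
rewrite alphaD -[a *: rat_coact m]/(rat_coact m ** (a : A)) alpha_rscale.
by rewrite !alpha_rat_coact rscaleDl rscaleA.
Qed.
HB.instance Definition _ := GRing.isLinear.Build A^c (restr M) (tensor (restr M) C)
  *:%R rat_coact rat_coact_linear.

(** Under [bialpha b b'] the two sides become [m ** b ** b'] and [m ** (b * b')]. *)
Lemma rat_coact_coassoc m :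
  tassoc (tmap (M' := tensor (restr M) C) rat_coact idfun (rat_coact m)) =
  tmap (M' := restr M) idfun (comul C) (rat_coact m).
Proof.
apply: (@bialpha_inj _ _ _ _ T) => b b'.
rewrite bialpha_tassoc bialpha_comul alpha_tmap => [|x y|n a].
- by rewrite !alpha_rat_coact rscaleA.
- exact: linearD.
- exact: rscale_linear.
Qed.

(** Evaluation at [b = 1], where beta gives the counit. *)
Lemma rat_coact_counit m :
  tlift (fun (m' : restr M) (c : C) => m' ** (counit C c : A)) (rat_coact m) = m.
Proof.
rewrite -[RHS](rscale1 (m : M)) -alpha_rat_coact.
rewrite -[RHS]/(tlift (fun n c => n ** T c 1) (rat_coact m)).
congr (tlift _ _); apply/funext => n; apply/funext => c.
by rewrite -(beta1 T).
Qed.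

Definition rat_comodule : comodule C :=
  Comodule (coact := rat_coact) rat_coact_coassoc rat_coact_counit.

(** The identity on elements, between two B-actions that agree only by [alpha_rat_coact]. *)
Definition to_rat_comodule (m : M) : toB T rat_comodule := m.
Lemma to_rat_comodule_linear : linear to_rat_comodule.
Proof.
by move=> b m n; congr (_ + _); rewrite -[RHS]/(alpha T (rat_coact m) b) alpha_rat_coact.
Qed.
HB.instance Definition _ := GRing.isLinear.Build B^c M (toB T rat_comodule)
  *:%R to_rat_comodule to_rat_comodule_linear.

Definition of_rat_comodule (m : toB T rat_comodule) : M := m.
Lemma of_rat_comodule_linear : linear of_rat_comodule.
Proof. by move=> b m n; exact/esym/(to_rat_comodule_linear b (m : M) (n : M)). Qed.
HB.instance Definition _ := GRing.isLinear.Build B^c (toB T rat_comodule) M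
  *:%R of_rat_comodule of_rat_comodule_linear.
End RationalComodule.

(** * Comodules as a full subcategory of B-modules *)

Section Fullness.
Variables (K : comPzRingType) (A : kalgebra K) (C : coring A) (B : aring A).
Variables (T : rational_pairing C B).

(** Since [alpha T (coact M m)] is A-linear, the claim reduces to [m ** 1 = m]. *)
Lemma toB_rscale_map (M : comodule C) (m : toB T M) (a : A) :
  m ** aring_map B a = ((m : M) ** a : M).
Proof.
rewrite -[LHS]/(alpha T (coact M m) (aring_map B a)) -[aring_map B a]mul1r.
rewrite -[_ * _]/((a : A^c) *: (1 : restr (right_regular B))) linearZ.
exact: (congr1 (fun n : M => n ** a) (rscale1 m)).
Qed.

Lemma toB_rational (M : comodule C) (m : toB T M) : rational T m.
Proof.
have [s sE] := tensor_sum (coact M m).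
exists [seq (p.2, p.1 : toB T M) | p <- s] => b.
rewrite -[LHS]/(alpha T (coact M m) b) sE big_map.
elim: {sE} s => [|p s IHs]; last first.
  by rewrite !big_cons alphaD alpha_pure IHs toB_rscale_map.
by rewrite !big_nil; apply: (addrI (alpha T (0 : tensor M C) b));
  rewrite -alphaD !addr0.
Qed.

Section OfB.
Variables (M N : comodule C) (f : {linear toB T M -> toB T N}).
Definition ofB_fun (m : M) : N := f m.
Let ofB_linear : linear ofB_fun.
Proof.
have scaleE (P : comodule C) (p : P) a : a *: p = (p : toB T P) ** aring_map B a.
  exact/esym/(toB_rscale_map (p : toB T P)).
move=> a m n; rewrite (scaleE M m) (scaleE N (ofB_fun m)).
exact: (linearP f (aring_map B a : B^c)).
Qed.
HB.instance Definition _ := GRing.isLinear.Build A^c M N *:%R ofB_fun ofB_linear.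
(** After applying the injective alpha, colinearity reads as B-linearity of [f]. *)
Lemma ofB_coact m : coact N (ofB_fun m) = tmap (N' := C) ofB_fun idfun (coact M m).
Proof.
apply: (@alpha_inj _ _ _ _ T); apply: linear_eq => b.
rewrite alpha_tmap => [|x y|x a]; [|exact: linearD|exact: rscale_linear].
exact/esym/(rscale_linear f (m : toB T M) b).
Qed.
Definition ofB : comodule_hom M N := ComoduleHom (comodule_hom_map := ofB_fun) ofB_coact.
End OfB.
End Fullness.

Lemma linear_app (R : pzRingType) (U V : lmodType R) (f g : {linear U -> V}) :
  f = g -> f =1 g.
Proof. by move->. Qed.

(** * Factoring linear maps; monomorphisms and injective objects *)

Section LinearExistence.
Variables (R : pzRingType) (X Y Z : lmodType R).

Lemma linear_ex (g : X -> Y) : linear g -> exists g' : {linear X -> Y}, g' =1 g.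
Proof.
by move=> gl; exists (HB.pack_for {linear X -> Y} g (GRing.isLinear.Build _ _ _ _ g gl)).
Qed.

(** Preimages are chosen pointwise; injectivity of [z] forces the choice to be linear. *)
Lemma linear_lift (z : {linear Y -> Z}) (f : {linear X -> Z}) :
  injective z -> (forall x, exists y, z y = f x) ->
  exists g : {linear X -> Y}, forall x, z (g x) = f x.
Proof.
move=> zI zf; pose g x := sval (cid (zf x)).
have gE x : z (g x) = f x by rewrite /g; case: cid.
have /linear_ex[g' g'E] : linear g.
  by move=> a x y; apply: zI; rewrite gE !linearP !gE.
by exists g' => x; rewrite g'E.
Qed.
End LinearExistence.

Lemma mono_split (X : category) (x y : X) (i : hom x y) (r : hom y x) :
  comp r i = idmor x -> mono i.
Proof.
by move=> ri z g h /(congr1 (comp r)); rewrite !compA ri !comp_idl.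
Qed.

(** A mono is tested on the regular module: if [f x = f y], then [f] equalizes [act x] and
    [act y]. *)
Lemma RMod_mono (R : pzRingType) (M N : RMod R) (f : hom M N) :
  mono f <-> injective (f : {linear (M : rmodType R) -> (N : rmodType R)}).
Proof.
split=> [fm x y fxy|fI Z g h gh]; last first.
  by apply: linear_eq => z; apply: fI; move: gh => /linear_app/(_ z).
suff /linear_app/(_ 1) :
    (act x : {linear right_regular R -> (M : rmodType R)}) = act y.
  by rewrite /= /act !rscale1.
apply: (fm (right_regular R : rmodType R)); apply: linear_eq => b.
by rewrite /= /act !rscale_linear fxy.
Qed.

Lemma injective_iso (X : category) (x y : X) (f : hom x y) :
  is_iso X f -> injective_object X y -> injective_object X x.
Proof.
move=> [g [gf fg]] yI u v i h im; have [k kE] := yI _ _ i (comp f h) im.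
by exists (comp g k); rewrite -compA kE compA gf comp_idl.
Qed.

(** Injectivity of [x] gives a retraction of [i]; essentiality makes it mono, and a split epi that
    is mono is invertible. *)
Lemma essential_injective_iso (X : category) (x y : X) (i : hom x y) :
  injective_object X x -> essential_mono i -> is_iso X i.
Proof.
move=> xI [im ie]; have [r rE] := xI _ _ i (idmor x) im.
exists r; split=> //; apply: (ie _ r); first by rewrite rE; exact: (mono_split (comp_idl _)).
by rewrite compA rE comp_idl comp_idr.
Qed.

(** * The image of zeta in the module of homomorphisms from the ideal *)

Section ExactRat.
Variables (K : comPzRingType) (A : kalgebra K) (C : coring A) (B : aring A).
Variables (T : rational_pairing C B).
Hypothesis Rat_exact : exact_functor (Rat_functor T).

Lemma toB_local_unit (M : comodule C) (m : toB T M) :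
  exists u : rat_ideal T, m ** rat_incl u = m.
Proof. exact/rational_local_unit/toB_rational. Qed.

Lemma zetaE (M E : comodule C) (j : comodule_hom M E) m x :
  (zeta T j m : {linear _ -> _}) x = toB_hom T j m ** rat_incl x.
Proof. exact: rscale_linear. Qed.

Section HomIdeal.
Variable E : comodule C.

(** Each [e] equals [e ** u] for some [u] in the ideal, so [e] is a value of its own zeta. *)
Lemma zeta_id_inj : injective (zeta T (comod_id E)).
Proof.
apply: raddf_inj => e /linear_app ze; have [u <-] := toB_local_unit e.
by have := ze u; rewrite zetaE.
Qed.

(** At [y] both sides equal [h] of the product of [x] and [y], by right B-linearity of [h]. *)
Lemma Hom_ideal_rscale (h : Hom_ideal T (toB T E)) (x : rat_ideal T) :
  h ** rat_incl x = zeta T (comod_id E) ((h : {linear _ -> _}) x).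
Proof.
apply: linear_eq => y; rewrite zetaE.
rewrite -[RHS](rscale_linear (h : {linear _ -> _})).
by congr ((h : {linear _ -> _}) _); exact: val_inj.
Qed.

Lemma Hom_ideal_rational (h : Hom_ideal T (toB T E)) :
  rational T h -> exists e, zeta T (comod_id E) e = h.
Proof.
move=> /(rational_local_unit Rat_exact)[u hu].
by exists ((h : {linear _ -> _}) u); rewrite -Hom_ideal_rscale.
Qed.
End HomIdeal.

Lemma zeta_comp (M E : comodule C) (j : comodule_hom M E) m :
  zeta T j m = zeta T (comod_id E) (j m).
Proof. by apply: linear_eq => x; rewrite !zetaE. Qed.

(** The ideal, itself a comodule, serves as test object: if [f m = 0] then [f] kills the map
    [x |-> m x], which is therefore zero, and [m = m u = 0]. *)
Lemma Comod_mono (M N : Comod C) (f : hom M N) :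
  mono f <-> injective (f : comodule_hom (M : comodule C) (N : comodule C)).
Proof.
split=> [fm|fI Z g h gh]; last first.
  apply: comodule_hom_eq => z; apply: fI.
  by have /(congr1 (fun k : comodule_hom _ _ => k z)) := gh.
apply: raddf_inj => m fm0; have [u <-] := toB_local_unit (m : toB T M).
pose I := rat_comodule (@Rat_all_rational _ _ _ _ _ Rat_exact (right_regular B)).
pose g := ofB ((zeta T (comod_id M) m : {linear rat_ideal T -> _})
               \o @of_rat_comodule _ _ _ _ _ _ _ : {linear toB T I -> toB T M}).
pose g0 := ofB (\0 : {linear toB T I -> toB T M}).
have /(congr1 (fun k : comodule_hom I M => k u)) : g = g0.
  apply: fm; apply: comodule_hom_eq => x /=.
  rewrite [RHS]linear0 -[LHS]/(toB_hom T f (zeta T (comod_id M) m (x : rat_ideal T))).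
  by rewrite zetaE rscale_linear [toB_hom T f _]fm0 rscale0l.
by rewrite /= /ofB_fun /= => <-; rewrite zetaE.
Qed.

End ExactRat.

(** * Injectivity and essentiality of the envelope *)

Section Envelope.
Variables (K : comPzRingType) (A : kalgebra K) (C : coring A) (B : aring A).
Variables (T : rational_pairing C B).
Hypothesis Rat_exact : exact_functor (Rat_functor T).

Definition Rat_as_comodule (N : rmodType B) : comodule C :=
  rat_comodule (@Rat_all_rational _ _ _ _ _ Rat_exact N).

Definition to_Rat (N : rmodType B) : {linear Rat T N -> toB T (Rat_as_comodule N)} :=
  @to_rat_comodule _ _ _ _ _ _ _.

Definition of_Rat (N : rmodType B) : {linear toB T (Rat_as_comodule N) -> Rat T N} :=
  @of_rat_comodule _ _ _ _ _ _ _.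

(* [Hom_B(N, Hom_B(a, E)) = Hom(Rat N, E)]: the extension over [Rat Y] comes
   from injectivity of [E], and is transported back along the same bijection. *)
Lemma Hom_ideal_injective (E : comodule C) :
  injective_object (Comod C) E -> injective_object (RMod B) (Hom_ideal T (toB T E)).
Proof.
move=> EI X Y i f /RMod_mono iI.
(* On rational elements [f] lands in the image of zeta, hence factors there through a map [g] into
   [E]. *)
have fR (x : Rat T (X : rmodType B)) :
    exists e, zeta T (comod_id E) e = (f : {linear (X : rmodType B) -> _}) (\val x).
  by apply: (Hom_ideal_rational Rat_exact); apply: rational_map; exact: Rat_rational.
have [g gE] := @linear_lift _ _ _ _ _
  ((f : {linear (X : rmodType B) -> _}) \o (\val : {linear Rat T (X : rmodType B) -> _}))
  (@zeta_id_inj _ _ _ _ _ Rat_exact E) fR.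
pose i' := ofB (to_Rat Y \o Rat_map T (i : {linear _ -> _}) \o of_Rat X).
have [|k /(congr1 (fun k : comodule_hom _ _ => (k : _ -> _))) kE] :=
    EI (Rat_as_comodule X) (Rat_as_comodule Y) i' (ofB (g \o of_Rat X)).
  apply/(Comod_mono Rat_exact) => x y /(congr1 val)/= /iI; exact: val_inj.
(* The map [a |-> k (y a)], meaningful because [y a] is rational for [a] in the ideal. *)
pose F (y : (Y : rmodType B)) : Hom_ideal T (toB T E) :=
  toB_hom T k \o to_Rat Y \o Rat_map T (act y).
have /linear_ex[F' F'E] : linear F.
  move=> b y y'; apply: linear_eq => x.
  rewrite -[RHS]/(F y (rat_ideal_lmul b x) + F y' x) /F /= -!linearD.
  congr (toB_hom T k (to_Rat Y _)); apply: val_inj.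
  by rewrite /= /act rscaleDl rscaleA.
exists F'; apply: linear_eq => x; rewrite /= F'E; apply: linear_eq => a.
have -> : (F (i x) : {linear _ -> _}) a = g (Rat_map T (act (x : (X : rmodType B))) a).
  rewrite -[RHS](congr1 (fun h => h _) kE) /F /=.
  congr (k _); apply: val_inj => /=.
  exact/esym/rscale_linear.
(* Under zeta both sides become [f] of [x a], by B-linearity of [f]. *)
apply: (zeta_id_inj Rat_exact); rewrite gE -Hom_ideal_rscale.
exact: rscale_linear.
Qed.

Lemma zeta_inj (M E : comodule C) (j : comodule_hom M E) :
  injective j -> injective (zeta T j).
Proof.
move=> jI m n mn; apply: jI; apply: (zeta_id_inj Rat_exact).
exact: etrans (esym (zeta_comp j m)) (etrans mn (zeta_comp j n)).
Qed.

Lemma zeta_essential (M E : comodule C) (j : comodule_hom M E) :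
  essential_mono (X := Comod C) j -> essential_mono (X := RMod B) (zeta T j).
Proof.
move=> [/(Comod_mono Rat_exact) jI jE].
split=> [|Z g /RMod_mono gzI]; first exact/RMod_mono/zeta_inj.
have gR (e : toB T E) : exists z : Rat T (Z : rmodType B), \val z =
    (g : {linear _ -> (Z : rmodType B)}) (zeta T (comod_id E) e).
  by apply/RatP/rational_map/rational_map/toB_rational.
(* Restricted to the copy of [E], [g] takes rational values and becomes a comodule map; it is
   injective on [M], hence on [E] since [j] is essential. *)
have [k kE] := linear_lift (z := \val : {linear Rat T (Z : rmodType B) -> _})
  (f := (g : {linear _ -> (Z : rmodType B)}) \o zeta T (comod_id E)) val_inj gR.
have /(Comod_mono Rat_exact) kI : mono (X := Comod C) (ofB (to_Rat Z \o k)).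
  apply: jE; apply/(Comod_mono Rat_exact) => m n mn.
  have gmn : \val (k (j m)) = \val (k (j n)) := congr1 (@rat_val _ _ _ _ T Z) mn.
  apply: gzI; rewrite !kE in gmn.
  exact: etrans (congr1 g (zeta_comp j m)) (etrans gmn (esym (congr1 g (zeta_comp j n)))).
(* If [g h = 0], then [g] kills [h x], which is zeta of the value of [h] at [x]; so each value
   vanishes. *)
apply/RMod_mono; apply: raddf_inj => h gh0; apply: linear_eq => x.
apply: kI; apply: val_inj.
have -> : \val (ofB (to_Rat Z \o k) (h x)) = \val (k (h x)) by [].
rewrite kE /= linear0 -Hom_ideal_rscale.
by rewrite rscale_linear gh0 rscale0l.
Qed.

Lemma zeta_envelope (M E : comodule C) (j : comodule_hom M E) :
  injective_envelope (Comod C) j -> injective_envelope (RMod B) (zeta T j).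
Proof. by case=> /Hom_ideal_injective ? /zeta_essential ?; split. Qed.

(** Monos are the injective maps in both categories, and by fullness the B-linear extension is
    colinear. *)
Lemma Comod_injective (M : comodule C) :
  injective_object (RMod B) (toB T M) -> injective_object (Comod C) M.
Proof.
move=> MI X Y i f /(Comod_mono Rat_exact) iI.
have [|g /linear_app gE] := MI (toB T X) (toB T Y) (toB_hom T i) (toB_hom T f).
  exact/RMod_mono.
by exists (ofB g); apply: comodule_hom_eq => x; exact: gE.
Qed.

Lemma finite_support_injective (M : comodule C) (L : B -> Prop) :
  local_units (R := B) (rational T (M := right_regular B)) L ->
  finite_support L (toB T M) ->
  injective_object (Comod C) M -> injective_object (RMod B) (toB T M).
Proof.
move=> [LI Lid LC LU] [F [_ FL FE]] MI.
pose s : B := \sum_(e <- F) e.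
have sR : rational T (s : right_regular B).
  rewrite /s big_seq; elim/big_ind: _ => [|x y|e /FL/LI //]; first exact: rational0.
  exact: rationalD.
have [s' s'E] := RatP sR.
have sC e : L e -> s * e = e * s.
  move=> Le; rewrite /s mulr_suml mulr_sumr !big_seq; apply: eq_bigr => e' /FL Le'.
  exact: LC.
(* As [M] is injective, its identity is an envelope; it remains to show that the corresponding zeta
   is onto. *)
have [] : injective_envelope (RMod B) (zeta T (comod_id M)).
  apply: zeta_envelope; split=> //; split; last by move=> Z g; rewrite comp_idr.
  exact: (mono_split (comp_idl (idmor (M : Comod C)))).
move=> HI _; apply: (injective_iso _ HI).
have zS h : exists m, zeta T (comod_id M) m = h.
  (* With [x = e x] for a local unit [e]: [h(s) e = h(s e) = h(e s) = h(e) s = h(e)], hence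
     [h(x) = h(e) x = h(s) x]. *)
  exists ((h : {linear _ -> _}) s'); apply: linear_eq => x; rewrite zetaE.
  have [e [Le _ ex]] := LU _ (Rat_rational x).
  have [e' e'E] := RatP (LI e Le).
  have hl (y z w : rat_ideal T) : rat_incl y * rat_incl z = rat_incl w ->
      (h : {linear _ -> _}) w = (h : {linear _ -> _}) y ** rat_incl z.
    by move=> yz; rewrite -rscale_linear; congr ((h : {linear _ -> _}) _); apply: val_inj.
  have s'I : rat_incl s' = s := s'E; have e'I : rat_incl e' = e := e'E.
  have es : rat_incl e' * rat_incl s' = rat_incl (rat_ideal_lmul e s') by rewrite e'I.
  have se : rat_incl s' * rat_incl e' = rat_incl (rat_ideal_lmul e s').
    by rewrite -es e'I s'I sC.
  have hse : (h : {linear _ -> _}) s' ** rat_incl e' = (h : {linear _ -> _}) e'.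
    by rewrite -(hl _ _ _ se) (hl _ _ _ es) s'I; exact: FE.
  have ex' : rat_incl e' * rat_incl x = rat_incl x by rewrite e'I.
  by rewrite (hl _ _ _ ex') -hse -rscaleA ex'.
have [g gE] := linear_lift (f := idfun) (@zeta_id_inj _ _ _ _ _ Rat_exact M) zS.
exists g; split; apply: linear_eq => x; last exact: gE.
by apply: (zeta_id_inj Rat_exact); rewrite gE.
Qed.
End Envelope.

(** * Extension of scalars, left adjoint to restriction *)

Section ExtensionOfScalars.
Variables (K : comPzRingType) (A : kalgebra K) (B : aring A).

Section Module.
Variable X : rmodType A.
Definition extension : Type := tensor X (aring_left B).
HB.instance Definition _ := GRing.Zmodule.on extension.
Definition extension_scale (b : B^c) (t : extension) : extension :=
  tlift (fun (x : X) (b' : aring_left B) => x \ox (((b' : B) * b : B) : aring_left B)) t.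

Let extension_balanced (b : B) : balanced (fun (x : X) (b' : aring_left B) =>
  x \ox (((b' : B) * b : B) : aring_left B)).
Proof.
split=> [x x' b'|x b1 b2|x a b']; first exact: pureDl.
  by rewrite -pureDr; congr (_ \ox _); exact: (@mulrDl B).
by rewrite pure_bal; congr (_ \ox _); exact: (@mulrA B).
Qed.

Lemma extension_scale_pure (b : B) (x : X) (b' : B) :
  extension_scale b (x \ox (b' : aring_left B)) = x \ox ((b' * b : B) : aring_left B).
Proof. exact: tlift_pure (extension_balanced b). Qed.

Lemma extension_scaleDr : right_distributive extension_scale +%R.
Proof. by move=> b s t; exact: (tliftD _ _ (extension_balanced b)). Qed.

Let extension_scaleA a b t :
  extension_scale a (extension_scale b t) = extension_scale (a * b) t.
Proof.
apply: (tensor_ext (f := extension_scale a \o extension_scale b)) => [x y|x y|x c] /=.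
- by rewrite !extension_scaleDr.
- by rewrite extension_scaleDr.
- by rewrite !extension_scale_pure; congr (_ \ox _); exact/esym/(@mulrA B).
Qed.

Let extension_scale1 t : extension_scale 1 t = t.
Proof.
apply: (tensor_ext (g := id)) => [x y|//|x c]; first exact: extension_scaleDr.
by rewrite extension_scale_pure; congr (_ \ox _); exact: (@mulr1 B).
Qed.

Let extension_scaleDl t : {morph extension_scale^~ t : a b / a + b}.
Proof.
move=> a b; apply: (tensor_ext (f := extension_scale (a + b))
  (g := fun t => extension_scale a t + extension_scale b t)) => [x y|x y|x c].
- exact: extension_scaleDr.
- by rewrite !extension_scaleDr addrACA.
rewrite !extension_scale_pure -pureDr; congr (_ \ox _); exact: (@mulrDr B).
Qed.

HB.instance Definition _ := GRing.Zmodule_isLmodule.Build B^c extension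
  extension_scaleA extension_scale1 extension_scaleDr extension_scaleDl.
End Module.

Section Map.
Variables (X Y : rmodType A) (f : {linear X -> Y}).
Definition extension_map : extension X -> extension Y :=
  tmap f (idfun : aring_left B -> aring_left B).

Lemma extension_map_pure x (b : aring_left B) :
  extension_map (x \ox b) = f x \ox b.
Proof. by apply: tmap_pure => //; [exact: linearD | exact: rscale_linear]. Qed.
Lemma extension_mapD : {morph extension_map : s t / s + t}.
Proof. by apply: tmapD => //; [exact: linearD | exact: rscale_linear]. Qed.

Let extension_map_linear : linear extension_map.
Proof.
move=> b s t; rewrite extension_mapD; congr (_ + _).
apply: (tensor_ext (f := fun s => extension_map (b *: (s : extension X)))
  (g := fun s => b *: (extension_map s))) => [x y|x y|x c].
- by rewrite -extension_mapD; congr extension_map; exact: extension_scaleDr.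
- by rewrite extension_mapD; exact: extension_scaleDr.
rewrite extension_map_pure [RHS]extension_scale_pure -extension_map_pure.
congr extension_map; exact: extension_scale_pure.
Qed.
HB.instance Definition _ := GRing.isLinear.Build B^c (extension X) (extension Y)
  *:%R extension_map extension_map_linear.
End Map.

Section Lift.
Variables (X : rmodType A) (N : rmodType B) (f : {linear X -> restr N}).
Definition extension_lift : extension X -> N :=
  tlift (fun (x : X) (b : aring_left B) => (f x : N) ** (b : B)).

Let lift_balanced : balanced (fun (x : X) (b : aring_left B) => (f x : N) ** (b : B)).
Proof.
split=> [x x' b|x b b'|x a b]; first by rewrite linearD; exact: rscaleDl.
  exact: rscaleDr.
by rewrite rscale_linear; exact/esym/(@rscaleA _ N).
Qed.
Lemma extension_lift_pure x (b : aring_left B) :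
  extension_lift (x \ox b) = (f x : N) ** (b : B).
Proof. exact: tlift_pure lift_balanced. Qed.
Let extension_lift_linear : linear extension_lift.
Proof.
have liftD : {morph extension_lift : s t / s + t}.
  by move=> s t; exact: tliftD lift_balanced.
move=> b s t; rewrite liftD; congr (_ + _).
apply: (tensor_ext (f := fun s => extension_lift (b *: (s : extension X)))
  (g := fun s => b *: (extension_lift s))) => [x y|x y|x c].
- by rewrite scalerDr liftD.
- by rewrite liftD scalerDr.
transitivity (extension_lift (x \ox ((c : B) * (b : B) : aring_left B))).
  by congr extension_lift; exact: extension_scale_pure.
rewrite !extension_lift_pure; exact: rscaleA.
Qed.
HB.instance Definition _ := GRing.isLinear.Build B^c (extension X) N
  *:%R extension_lift extension_lift_linear.
End Lift.

Lemma flat_restr_injective (N : rmodType B) :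
  flat (aring_left B) -> injective_object (RMod B) N -> injective_object (RMod A) (restr N).
Proof.
move=> Bflat NI X Y i f /RMod_mono iI.
have [|g /linear_app gE] := NI (extension X) (extension Y)
    (extension_map (i : {linear _ -> _})) (extension_lift f).
  by apply/RMod_mono; exact: Bflat.
(* Transposing [g] back means evaluating it on [y \ox 1]; A-linearity holds because [a] crosses the
   tensor sign. *)
have /linear_ex[h hE] : linear (fun y : (Y : rmodType A) =>
    (g : {linear extension Y -> N}) (y \ox (1 : aring_left B)) : restr N).
  move=> a y y'; rewrite pureDl linearD; congr (_ + _).
  rewrite -[RHS](rscale_linear (g : {linear _ -> _})).
  congr ((g : {linear _ -> _}) _).
  rewrite [RHS]extension_scale_pure -[a *: y]/(y ** (a : A)) pure_bal.
  congr (_ \ox _).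
  exact: etrans (mulr1 (aring_map B a)) (esym (mul1r (aring_map B a))).
exists h; apply: linear_eq => x; rewrite /= hE.
rewrite -extension_map_pure; have /= -> := gE (x \ox (1 : aring_left B)).
rewrite extension_lift_pure; exact: (@rscale1 _ N).
Qed.
End ExtensionOfScalars.

Section RestrictComodule.
Variables (K : comPzRingType) (A : kalgebra K) (C : coring A) (B : aring A).
Variables (T : rational_pairing C B).

(** The identity identifies [M] with the restriction of [toB T M], by [toB_rscale_map]. *)
Lemma flat_toB_injective (M : comodule C) :
  flat (aring_left B) -> injective_object (RMod B) (toB T M) ->
  injective_object (RMod A) M.
Proof.
move=> Bflat /(flat_restr_injective Bflat) MI.
have fl : linear (fun m : M => m : restr (toB T M)).
  move=> a m n; congr (_ + _); exact/esym/(toB_rscale_map (m : toB T M)).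
have gl : linear (fun m : restr (toB T M) => m : M).
  move=> a m n; congr (_ + _); exact: (toB_rscale_map (m : toB T M)).
have [f fE] := linear_ex fl; have [g gE] := linear_ex gl.
apply: (injective_iso (f := f : hom (M : RMod A) (restr (toB T M) : rmodType A)) _ MI).
by exists g; split; apply: linear_eq => m /=; rewrite ?fE ?gE ?fE.
Qed.
End RestrictComodule.

Theorem proposition1p12 (K : comPzRingType) (A : kalgebra K) (C : coring A)
    (B : aring A) (T : rational_pairing C B)
    (Rat_exact : exact_functor (Rat_functor T)) (M : comodule C) :
  (forall (E : comodule C) (j : comodule_hom M E),
     injective_envelope (Comod C) j ->
     [/\ (* (a) *)
         injective_envelope (RMod B) (zeta T j),
         (* (b) *)
         injective_object (RMod B) (toB T M) <->
           injective_object (Comod C) M /\ is_iso (RMod B) (zeta T j)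
       & (* (c) *)
         flat (aring_left B) -> is_iso (RMod B) (zeta T j) ->
         injective_object (Comod C) M -> injective_object (RMod A) M])
  /\ (* (d) *)
  (forall L : B -> Prop,
     local_units (R := B) (rational T (M := right_regular B)) L ->
     finite_support L (toB T M) ->
     (injective_object (Comod C) M <->
      injective_object (RMod B) (toB T M)))
  /\ (* (e) *)
  (forall L : B -> Prop,
     local_units (R := B) (rational T (M := right_regular B)) L ->
     finite_support L (toB T M) -> flat (aring_left B) ->
     injective_object (Comod C) M -> injective_object (RMod A) M).
Proof.
split=> [E j jE|].
  have [HI zE] := zeta_envelope Rat_exact jE.
  (* If zeta is invertible, [M] inherits injectivity over [B] from the envelope; this serves both
     (b) and (c). *)
  have iso_inj zI := injective_iso zI HI.
  split=> [||Bflat /iso_inj MI _]; last exact: flat_toB_injective Bflat MI.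
    by split.
  split=> [MI|[_ /iso_inj]] //; split; first exact: (Comod_injective Rat_exact MI).
  exact: essential_injective_iso MI zE.
split=> L Lu Lf => [|Bflat MI].
  by split=> [|/(Comod_injective Rat_exact) //]; exact: (finite_support_injective Rat_exact Lu Lf).
exact: flat_toB_injective Bflat (finite_support_injective Rat_exact Lu Lf MI).
Qed.
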